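(* Let $t\le n$ and $t\le m$. For a $t$-doped POVM on $n$ data qubits with $m$ ancillas whose associated projected Heisenberg-evolved states are maximally entangled stabilizer states (in the sense defined in the context), one has $s_{\boldsymbol\mu}\le 2^n\left(\tfrac32\right)^t$.
   Context: A $t$-doped POVM: $m$ ancilla qubits in a stabilizer state $\ket\psi$, a unitary $U$ on $n+m$ qubits given by a circuit of Clifford gates and exactly $t$ gates $T=\mathrm{diag}(1,e^{i\pi/4})$, and a measurement in a stabilizer basis $\{\ket{\Phi'_b}\}$ of $n+m$ qubits; elements $\mu_b=(I\otimes\bra\psi)U^\dagger\ket{\Phi'_b}\!\bra{\Phi'_b}U(I\otimes\ket\psi)$ on $n$ qubits, and $s_{\boldsymbol\mu}=\dim\operatorname{span}\{\mu_b\}$. Gadget picture: replacing each $T$ gate acting on a qubit $q$ by a CNOT with control $q$ and target a fresh gadget qubit prepared in $\ket T=(\ket0+e^{i\pi/4}\ket1)/\sqrt2$ and projected onto $\ket0$ at the end, one obtains a Clifford circuit $\tilde U$ on $n+m+t$ qubits with $\mu_b=(I_n\otimes\bra\psi\otimes\bra{T}^{\otimes t})\tilde U^\dagger(\ket{\Phi'_b}\!\bra{\Phi'_b}\otimes\ket{0^t}\!\bra{0^t})\tilde U(I_n\otimes\ket\psi\otimes\ket T^{\otimes t})$. The associated projected Heisenberg-evolved states are the (unnormalized) vectors $(I_n\otimes\bra\psi\otimes I_t)\tilde U^\dagger(\ket{\Phi'_b}\otimes\ket{0^t})$ on $n+t$ qubits (data qubits and gadget qubits); these are (multiples of) stabilizer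 states, and the hypothesis is that the nonzero ones are maximally entangled between the $n$ data qubits and the $t$ gadget qubits. *)

(* Defs.v *)
From HB Require Import structures.
From mathcomp Require Import all_boot all_order all_algebra.
From mathcomp Require Import algC.
Unset Printing Implicit Defensive.
Import Order.TTheory GRing.Theory Num.Theory Num.Def.
Local Open Scope ring_scope.

(* Qubit convention: on N qubits, basis index i : 'I_(2^N); qubit q is the
   bit q of i (little endian): bit q i = odd (i %/ 2^q). *)
Definition bitn (q i : nat) : bool := odd (i %/ 2 ^ q).
Definition flipn (q i : nat) : nat := if bitn q i then (i - 2 ^ q)%N else (i + 2 ^ q)%N.

Inductive gate : Type :=
| GH of nat | GS of nat | GCNOT of nat & nat | GT of nat.

Definition gate_wf (N : nat) (g : gate) : bool :=
  match g with
  | GH q | GS q | GT q => q < N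
  | GCNOT c t => (c < N) && (t < N) && (c != t)
  end%N.

Definition isT (g : gate) : bool := if g is GT _ then true else false.

Definition adjmx {p q : nat} (A : 'M[algC]_(p, q)) : 'M[algC]_(q, p) :=
  (map_mx conjC A)^T.

Definition one_mx (N q : nat) (G : bool -> bool -> algC) : 'M[algC]_(2 ^ N) :=
  \matrix_(i, j) if [forall k : 'I_N, (k != q :> nat) ==> (bitn k i == bitn k j)]
                 then G (bitn q i) (bitn q j) else 0.

Definition cnot_mx (N c t : nat) : 'M[algC]_(2 ^ N) :=
  \matrix_(i, j) ((i : nat) == (if bitn c j then flipn t j else j))%:R.

Definition Hgate (a b : bool) : algC := (if a && b then -1 else 1) / sqrtC 2%:R.
Definition Sgate (a b : bool) : algC := if a == b then (if a then 'i else 1) else 0.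
(* e^{i pi/4} = (1 + i)/sqrt 2 *)
Definition omega8 : algC := (1 + 'i) / sqrtC 2%:R.
Definition Tgate (a b : bool) : algC := if a == b then (if a then omega8 else 1) else 0.

Definition gate_mx (N : nat) (g : gate) : 'M[algC]_(2 ^ N) :=
  match g with
  | GH q => one_mx N q Hgate
  | GS q => one_mx N q Sgate
  | GT q => one_mx N q Tgate
  | GCNOT c t => cnot_mx N c t
  end.

(* a circuit g1 :: g2 :: ... applies g1 first: U = G_k ... G_2 G_1 *)
Definition circ_mx (N : nat) (C : seq gate) : 'M[algC]_(2 ^ N) :=
  foldl (fun M g => gate_mx N g *m M) 1%:M C.

Definition circ_wf (N : nat) (C : seq gate) : bool := all (gate_wf N) C.
Definition countT (C : seq gate) : nat := count isT C.
Definition clifford_circ (N : nat) (C : seq gate) : bool :=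
  circ_wf N C && ~~ has isT C.

Definition ket0 (N : nat) : 'cV[algC]_(2 ^ N) := \col_(i < 2 ^ N) ((i : nat) == 0%N)%:R.

Definition stab_state (N : nat) (psi : 'cV[algC]_(2 ^ N)) : Prop :=
  exists C, clifford_circ N C /\ psi = circ_mx N C *m ket0 N.

Definition stab_basis (N : nat) (Phi : 'I_(2 ^ N) -> 'cV[algC]_(2 ^ N)) : Prop :=
  exists C, clifford_circ N C /\ forall b, Phi b = circ_mx N C *m delta_mx b 0.

Definition vget {p : nat} (v : 'cV[algC]_p) (k : nat) : algC :=
  if (insub k : option 'I_p) is Some j then v j 0 else 0.

(* v |-> v (x) |0...0> : pad with zero high bits *)
Definition pad {p : nat} (q : nat) (v : 'cV[algC]_p) : 'cV[algC]_q := \col_(i < q) vget v i.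

(* (I_n (x) <psi| (x) I_rest) w, registers: data (n low bits), ancilla (m bits),
   rest (high bits). *)
Definition contract (n m q p : nat) (psi : 'cV[algC]_(2 ^ m)) (w : 'cV[algC]_p)
  : 'cV[algC]_q :=
  \col_(i < q) \sum_(a < 2 ^ m)
     conjC (psi a 0) * vget w (i %% 2 ^ n + 2 ^ n * a + 2 ^ (n + m) * (i %/ 2 ^ n)).

Definition povm_elt (n m : nat) (U : seq gate) (psi : 'cV[algC]_(2 ^ m))
  (Phib : 'cV[algC]_(2 ^ (n + m))) : 'M[algC]_(2 ^ n) :=
  let w := contract n m (2 ^ n) (2 ^ (n + m)) psi
             (adjmx (circ_mx (n + m) U) *m Phib) in
  w *m adjmx w.

Definition povm_span_dim (n m : nat) (U : seq gate) (psi : 'cV[algC]_(2 ^ m))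
  (Phi : 'I_(2 ^ (n + m)) -> 'cV[algC]_(2 ^ (n + m))) : nat :=
  \rank (\matrix_(b < 2 ^ (n + m)) mxvec (povm_elt n m U psi (Phi b))).

Fixpoint gadgetize (base k : nat) (C : seq gate) : seq gate :=
  match C with
  | [::] => [::]
  | GT q :: C' => GCNOT q (base + k) :: gadgetize base k.+1 C'
  | g :: C' => g :: gadgetize base k C'
  end.

(* projected Heisenberg-evolved state on n + t qubits (data, then gadgets):
   (I_n (x) <psi| (x) I_t) Ut^dag (|Phi_b> (x) |0^t>) *)
Definition proj_heis (n m t : nat) (U : seq gate) (psi : 'cV[algC]_(2 ^ m))
  (Phib : 'cV[algC]_(2 ^ (n + m))) : 'cV[algC]_(2 ^ (n + t)) :=
  let Ut := circ_mx (n + m + t) (gadgetize (n + m) 0 U) in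
  contract n m (2 ^ (n + t)) (2 ^ (n + m + t)) psi
    (adjmx Ut *m pad (2 ^ (n + m + t)) Phib).

(* v on n data + t gadget qubits is maximally entangled (t <= n): the reduced
   state on the t gadget qubits is proportional to the identity. *)
Definition max_ent (n t : nat) (v : 'cV[algC]_(2 ^ (n + t))) : Prop :=
  let A := \matrix_(g < 2 ^ t, d < 2 ^ n) vget v (d + 2 ^ n * g) in
  exists c : algC, A *m adjmx A = c%:M.

(* Main.v *)
Require Import Defs.
From HB Require Import structures.
From mathcomp Require Import all_boot all_order all_algebra.
From mathcomp Require Import algC.
From mathcomp Require Import ring zify.
Import Order.TTheory GRing.Theory Num.Theory Num.Def.
Local Open Scope ring_scope.

(** Label the computational basis by vectors over F_2 and let P_v, v = (a, b), be the Pauli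
    operator X^a Z^b. Write the basis states, evolved through the gadgetized circuit, as
    D |k> with D Clifford, and psi = M |0>. Expanding D |k><k| D^dagger in Paulis, and
    contracting the ancillas with psi, the projected state phi_b satisfies
      phi_b phi_b^dagger = sum over (p, r) in G of c_b(p, r) P_p (x) P_r,
    where G is a subgroup, independent of b, of the Paulis on the n data and t gadget qubits.
    G is isotropic for the symplectic form, so |G| <= 2^(n+t). If phi_b is nonzero and
    maximally entangled, its partial traces against data operators give all operators on the
    gadgets, so G projects onto all 4^t gadget Paulis, and each fibre has at most 2^(n-t)
    elements. As <T|Z|T> = 0, only the pairs with P_r in {I, X, Y}^t contribute to mu_b:
    every mu_b is in the span of at most 3^t 2^(n-t) Paulis P_p. *)

(** * Bits *)

Lemma bitn_cat (q l c k : nat) : (l < 2 ^ q)%N ->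
  bitn k (l + 2 ^ q * c) = if (k < q)%N then bitn k l else bitn (k - q) c.
Proof.
move=> lq; rewrite /bitn; case: ltnP => kq.
  rewrite -(subnKC (ltnW kq)) expnD -mulnA divnDr ?dvdn_mulr //.
  by rewrite mulKn ?expn_gt0 // oddD oddM oddX subn_eq0 leqNgt kq /= addbF.
rewrite -{1}(subnKC kq) expnD divnMA divnDr ?dvdn_mulr //.
by rewrite mulKn ?expn_gt0 // (divn_small lq).
Qed.

Lemma bitn0 (i : nat) : bitn 0 i = odd i.
Proof. by rewrite /bitn divn1. Qed.

Lemma bitnS (q i : nat) : bitn q.+1 i = bitn q i./2.
Proof. by rewrite /bitn expnS divnMA divn2. Qed.

Lemma bitn_inj (N i j : nat) : (i < 2 ^ N)%N -> (j < 2 ^ N)%N ->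
  (forall q, (q < N)%N -> bitn q i = bitn q j) -> i = j.
Proof.
elim: N i j => [|N IH] i j; first by rewrite expn0; case: i j => [|i] [|j].
rewrite expnS => iN jN ij.
rewrite -[i]odd_double_half -[j]odd_double_half.
have := ij 0%N isT; rewrite !bitn0 => ->; congr (_ + _.*2)%N.
apply: IH; try lia.
by move=> q qN; rewrite -!bitnS ij.
Qed.

(** Bit q is the parity of the quotient [c], and the flip moves [c] to its partner of opposite
    parity; no carry or borrow reaches the low part [l]. *)
Lemma flipn_cat (q l c : nat) : (l < 2 ^ q)%N ->
  flipn q (l + 2 ^ q * c) = (l + 2 ^ q * (if odd c then c.-1 else c.+1))%N.
Proof.
move=> lq; rewrite /flipn bitn_cat // ltnn subnn bitn0.
have q0 : (0 < 2 ^ q)%N by rewrite expn_gt0.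
by case: ifP => oc; [case: c oc => //= c _; rewrite mulnS; lia | rewrite mulnS; lia].
Qed.

Lemma flip_parity (c : nat) (c' := if odd c then c.-1 else c.+1) :
  (c'./2 = c./2) /\ (odd c' = ~~ odd c).
Proof.
rewrite /c'; have [b [h ->]] : exists b : bool, exists h, c = (b + h.*2)%N.
  by exists (odd c), c./2; rewrite odd_double_half.
by case: b; rewrite ?(add0n, add1n) /= !odd_double /= ?uphalf_double ?doubleK ?odd_double.
Qed.

Lemma bitn_flip (q i k : nat) : bitn k (flipn q i) = bitn k i (+) (k == q).
Proof.
have q0 : (0 < 2 ^ q)%N by rewrite expn_gt0.
rewrite {1 2}(divn_eq i (2 ^ q)) addnC mulnC flipn_cat ?ltn_mod //.
rewrite !bitn_cat ?ltn_mod //; case: ltngtP => // [_|qk|->].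
- by rewrite addbF.
- rewrite addbF -(prednK (n := k - q)) ?subn_gt0 // !bitnS; congr (bitn _ _).
  exact: (flip_parity _).1.
by rewrite subnn !bitn0 addbT (flip_parity _).2.
Qed.

Lemma flipn_lt (N q i : nat) : (q < N)%N -> (i < 2 ^ N)%N -> (flipn q i < 2 ^ N)%N.
Proof.
move=> qN; have q0 : (0 < 2 ^ q)%N by rewrite expn_gt0.
rewrite (divn_eq i (2 ^ q)) addnC mulnC flipn_cat ?ltn_mod //.
have := ltn_pmod i q0; move: (i %% _)%N (i %/ _)%N => l c lq.
(* The quotient [c] lies below an even bound 2M, so exchanging the even number of a pair with its
   odd successor cannot cross it. *)
have -> : (2 ^ N = 2 ^ q * (2 * 2 ^ (N - q).-1))%N.
  by rewrite -expnS prednK ?subn_gt0 // -expnD subnKC // ltnW.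
move: (2 ^ (_.-1))%N => M lc.
have cM : (c < 2 * M)%N by rewrite -(ltn_pmul2l q0); lia.
have {lc} : ((if odd c then c.-1 else c.+1) < 2 * M)%N by case: ifP; lia.
by move: (if odd c then _ else _) => c'; rewrite -(leq_pmul2l q0) mulnS; lia.
Qed.

(** * Basis labels as vectors over F_2 *)

Definition bv (N i : nat) : 'rV['F_2]_N := \row_q (bitn q i)%:R.

Lemma F2P (x : 'F_2) : x = 0 \/ x = 1.
Proof. case: x => [[|[|m]] i]; [left | right | by []]; exact: val_inj. Qed.

Lemma F2b (b : bool) : ((b%:R : 'F_2) == 1) = b.
Proof. by case: b. Qed.

Lemma addF2 (N : nat) (x : 'rV['F_2]_N) : x + x = 0.
Proof. by apply/rowP => k; rewrite !mxE; case: (F2P (x 0 k)) => ->; apply/eqP. Qed.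

Lemma addF2K (N : nat) (x y : 'rV['F_2]_N) : x + y + y = x.
Proof. by rewrite -addrA addF2 addr0. Qed.

Lemma eq_addF2 (N : nat) (x y z : 'rV['F_2]_N) : (x == y + z) = (x + z == y).
Proof. by apply/eqP/eqP => [->|<-]; rewrite addF2K. Qed.

Lemma card_rVF2 (N : nat) : #|{: 'rV['F_2]_N}| = (2 ^ N)%N.
Proof. by rewrite card_mx card_Fp // mul1n. Qed.

Lemma bv_inj (N : nat) (i j : nat) : (i < 2 ^ N)%N -> (j < 2 ^ N)%N -> bv N i = bv N j -> i = j.
Proof.
move=> iN jN /rowP ij; apply: (bitn_inj N) => // q qN.
by have := ij (Ordinal qN); rewrite !mxE /= => e; rewrite -[LHS]F2b e F2b.
Qed.

Lemma bvi_inj (N : nat) : injective (fun i : 'I_(2 ^ N) => bv N i).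
Proof. by move=> i j /bv_inj e; apply/val_inj/e. Qed.

Lemma bvi_surj (N : nat) (x : 'rV['F_2]_N) : exists i : 'I_(2 ^ N), bv N i == x.
Proof.
have le : (#|{: 'rV['F_2]_N}| <= #|'I_(2 ^ N)|)%N by rewrite card_rVF2 card_ord.
by have /codomP[i ->] := inj_card_onto (@bvi_inj N) le x; exists i.
Qed.

(** The inverse of [bv N] on basis indices. Indexing amplitudes and entries by vectors over F_2
    turns bit flips into translations. *)
Definition enc (N : nat) (x : 'rV['F_2]_N) : 'I_(2 ^ N) := xchoose (bvi_surj N x).
Arguments enc {N}.

Lemma encK (N : nat) (x : 'rV['F_2]_N) : bv N (enc x) = x.
Proof. exact/eqP/(xchooseP (bvi_surj N x)). Qed.

Lemma bvK (N : nat) (i : 'I_(2 ^ N)) : enc (bv N i) = i.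
Proof. by apply: bvi_inj; rewrite encK. Qed.

Lemma enc_bij (N : nat) : bijective (@enc N).
Proof. by exists (fun i : 'I_(2 ^ N) => bv N i) => x; [apply: encK | apply: bvK]. Qed.

Lemma bv_cat (n m d a : nat) : (d < 2 ^ n)%N ->
  bv (n + m) (d + 2 ^ n * a) = row_mx (bv n d) (bv m a).
Proof.
move=> dn; apply/rowP => k; rewrite !mxE bitn_cat //.
by case: splitP => j /= kj; rewrite mxE kj // addKn.
Qed.

Definition amp {N : nat} (u : 'cV[algC]_(2 ^ N)) (x : 'rV['F_2]_N) : algC := u (enc x) 0.
Definition ent {N : nat} (M : 'M[algC]_(2 ^ N)) (x y : 'rV['F_2]_N) : algC := M (enc x) (enc y).

Lemma amp_eq (N : nat) (u v : 'cV[algC]_(2 ^ N)) : (forall x, amp u x = amp v x) -> u = v.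
Proof. by move=> uv; apply/colP => i; have := uv (bv N i); rewrite /amp bvK. Qed.

Lemma ent_eq (N : nat) (A B : 'M[algC]_(2 ^ N)) : (forall x y, ent A x y = ent B x y) -> A = B.
Proof.
by move=> AB; apply/matrixP => i j; have := AB (bv N i) (bv N j); rewrite /ent !bvK.
Qed.

Lemma sum_enc (N : nat) (F : 'I_(2 ^ N) -> algC) : \sum_i F i = \sum_x F (enc x).
Proof. by rewrite (reindex (@enc N)) //; apply/onW_bij/enc_bij. Qed.

Lemma amp_mul (N : nat) (M : 'M[algC]_(2 ^ N)) (u : 'cV[algC]_(2 ^ N)) x :
  amp (M *m u) x = \sum_y ent M x y * amp u y.
Proof. by rewrite /amp mxE sum_enc. Qed.

Lemma ent_adj (N : nat) (A : 'M[algC]_(2 ^ N)) x y : ent (adjmx A) x y = (ent A y x)^*.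
Proof. by rewrite /ent !mxE. Qed.

Lemma vget_bv (N : nat) (v : 'cV[algC]_(2 ^ N)) k : (k < 2 ^ N)%N -> vget v k = amp v (bv N k).
Proof.
move=> kN; rewrite /vget insubT /amp; congr (v _ 0).
by rewrite -[LHS]bvK.
Qed.

Lemma adjmxM p q r (A : 'M[algC]_(p, q)) (B : 'M_(q, r)) : adjmx (A *m B) = adjmx B *m adjmx A.
Proof. by rewrite /adjmx map_mxM trmx_mul. Qed.

Lemma adjmxK p q (A : 'M[algC]_(p, q)) : adjmx (adjmx A) = A.
Proof. by apply/matrixP => i j; rewrite !mxE conjCK. Qed.

(** * Pauli operators *)

(** The character (-1)^x of F_2. *)
Definition sg (x : 'F_2) : algC := if x == 0 then 1 else -1.

Lemma sgD x y : sg (x + y) = sg x * sg y.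
Proof.
by case: (F2P x) => ->; case: (F2P y) => ->; rewrite /sg /= ?mulr1 ?mul1r ?mulrNN ?mulr1.
Qed.

Lemma sg0 : sg 0 = 1. Proof. by []. Qed.

Lemma sg_sq x : sg x * sg x = 1.
Proof. by rewrite /sg; case: ifP => _; rewrite ?mulrNN mulr1. Qed.

Lemma sg_conj x : (sg x)^* = sg x.
Proof. by rewrite /sg; case: ifP => _; rewrite ?rmorphN ?rmorph1. Qed.

Lemma sg_neq0 x : sg x != 0.
Proof. by rewrite /sg; case: ifP => _; rewrite ?oppr_eq0 oner_eq0. Qed.

Lemma sg_eq1 x : sg x = 1 -> x = 0.
Proof.
rewrite /sg; case: eqP => // _ /eqP; rewrite -subr_eq0 -opprD oppr_eq0 => e.
by have := @pnatr_eq0 algC 2; rewrite -natr1 e.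
Qed.

Definition dot {N : nat} (b x : 'rV['F_2]_N) : 'F_2 := \sum_k b 0 k * x 0 k.

Lemma dotC N (b x : 'rV['F_2]_N) : dot b x = dot x b.
Proof. by apply: eq_bigr => k _; rewrite mulrC. Qed.

Lemma dotDr N (b x y : 'rV['F_2]_N) : dot b (x + y) = dot b x + dot b y.
Proof. by rewrite -big_split; apply: eq_bigr => k _; rewrite mxE mulrDr. Qed.

Lemma dotDl N (b c x : 'rV['F_2]_N) : dot (b + c) x = dot b x + dot c x.
Proof. by rewrite dotC dotDr !(dotC _ x). Qed.

Lemma dot0r N (b : 'rV['F_2]_N) : dot b 0 = 0.
Proof. by apply: big1 => k _; rewrite mxE mulr0. Qed.

Lemma dot_delta N (b : 'rV['F_2]_N) q : dot b (delta_mx 0 q) = b 0 q.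
Proof.
rewrite /dot (bigD1 q) //= big1 => [|k kq]; rewrite mxE eqxx ?eqxx ?mulr1 ?addr0 //.
by rewrite (negPf kq) mulr0.
Qed.

Lemma dot_row_mx N K (b x : 'rV['F_2]_N) (c y : 'rV['F_2]_K) :
  dot (row_mx b c) (row_mx x y) = dot b x + dot c y.
Proof.
by rewrite /dot big_split_ord /=; congr (_ + _); apply: eq_bigr => k _;
  rewrite ?row_mxEl ?row_mxEr.
Qed.

(** Reindexing by the translation [a] shows that the sum equals its own negative, and 2 is
    invertible. *)
Lemma sum_antisym N (a : 'rV['F_2]_N) (F : 'rV['F_2]_N -> algC) :
  (forall x, F (x + a) = - F x) -> \sum_x F x = 0.
Proof.
move=> Fa; have e : \sum_x F x = - \sum_x F x.
  rewrite {1}(reindex_inj (addIr a)) -sumrN.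
  by apply: eq_bigr => x _; rewrite Fa.
apply/eqP; have /eqP : \sum_x F x + \sum_x F x = 0 by rewrite {1}e addNr.
by rewrite -mulr2n -mulr_natr mulf_eq0 pnatr_eq0 orbF.
Qed.

Lemma sum_sg_dot N (w : 'rV['F_2]_N) : \sum_b sg (dot b w) = (2 ^ N)%:R * (w == 0)%:R.
Proof.
case: eqP => [->|/eqP w0].
  rewrite (eq_bigr (fun=> 1)) => [|b _]; last by rewrite dot0r.
  by rewrite sumr_const -cardsT cardsT card_rVF2 mulr1.
have [k wk] : exists k, w 0 k != 0.
  case: (pickP (fun k => w 0 k != 0)) => [k wk|wk]; first by exists k.
  case/eqP: w0; apply/rowP => k; rewrite mxE.
  by have /negbFE/eqP := wk k.
rewrite mulr0; apply: (sum_antisym _ (delta_mx 0 k)) => b.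
rewrite dotDl (dotC _ (delta_mx 0 k)) dot_delta sgD.
by case: (F2P (w 0 k)) wk => -> //; rewrite /sg /= mulrN1.
Qed.

(** X^a Z^b with Z acting first, hence the sign read off the column. No power of i is included, so
    the operator is Hermitian or anti-Hermitian according to [dot v.1 v.2], and all products and
    adjoints stay within signs. *)
Definition pauli {N : nat} (v : 'rV['F_2]_N * 'rV['F_2]_N) : 'M[algC]_(2 ^ N) :=
  \matrix_(i, j) ((bv N i == bv N j + v.1)%:R * sg (dot v.2 (bv N j))).

Definition sympl {N : nat} (v w : 'rV['F_2]_N * 'rV['F_2]_N) : 'F_2 :=
  dot v.2 w.1 + dot v.1 w.2.

Lemma ent_pauli N (v : 'rV['F_2]_N * 'rV['F_2]_N) x y :
  ent (pauli v) x y = (x == y + v.1)%:R * sg (dot v.2 y).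
Proof. by rewrite /ent mxE !encK. Qed.

Lemma sum_delta N (F : 'rV['F_2]_N -> algC) x : \sum_y (x == y)%:R * F y = F x.
Proof.
rewrite (bigD1 x) //= eqxx mul1r big1 ?addr0 // => y yx.
by rewrite eq_sym (negPf yx) mul0r.
Qed.

Lemma amp_pauli N (v : 'rV['F_2]_N * 'rV['F_2]_N) (u : 'cV_(2 ^ N)) x :
  amp (pauli v *m u) x = sg (dot v.2 (x + v.1)) * amp u (x + v.1).
Proof.
rewrite amp_mul -(sum_delta _ (fun y => sg (dot v.2 y) * amp u y)).
by apply: eq_bigr => y _; rewrite ent_pauli eq_addF2 mulrA.
Qed.

Lemma op_eq N (A B : 'M[algC]_(2 ^ N)) :
  (forall (u : 'cV_(2 ^ N)) x, amp (A *m u) x = amp (B *m u) x) -> A = B.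
Proof.
move=> AB; apply/matrixP => i j; have := AB (delta_mx j 0) (bv N i).
by rewrite /amp bvK -!colE !mxE.
Qed.

Lemma pauliM N (v w : 'rV['F_2]_N * 'rV['F_2]_N) :
  pauli v *m pauli w = sg (dot v.2 w.1) *: pauli (v + w).
Proof.
apply: op_eq => u x; rewrite -mulmxA -scalemxAl {2}/amp mxE -/(amp _ _) !amp_pauli /=.
rewrite addrA !mulrA; congr (_ * _).
rewrite dotDl !dotDr !sgD.
have := sg_sq (dot v.2 w.1); move: (sg _) (sg _) (sg _) => a b c.
by move=> e; rewrite !mulrA; ring : e.
Qed.

Lemma pauli0 N : pauli (0 : 'rV['F_2]_N * 'rV['F_2]_N) = 1%:M.
Proof.
apply: op_eq => u x; rewrite amp_pauli mul1mx /= addr0 dotC dot0r.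
by rewrite sg0 mul1r.
Qed.

Lemma pauli_adj N (v : 'rV['F_2]_N * 'rV['F_2]_N) :
  adjmx (pauli v) = sg (dot v.1 v.2) *: pauli v.
Proof.
apply: ent_eq => x y; rewrite ent_adj {2}/ent mxE -/(ent _ _ _) !ent_pauli.
rewrite rmorphM /= sg_conj rmorph_nat mulrCA eq_addF2 eq_sym.
case: eqP => [->|_]; last by rewrite !mul0r.
by rewrite dotDr sgD (dotC _ v.1) !mul1r mulrC.
Qed.

Lemma pauli_comm N (v w : 'rV['F_2]_N * 'rV['F_2]_N) :
  pauli v *m pauli w = sg (sympl v w) *: (pauli w *m pauli v).
Proof.
rewrite !pauliM scalerA [w + v]addrC /sympl sgD -mulrA (dotC _ v.1).
by rewrite sg_sq mulr1.
Qed.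

Lemma pauli_neq0 N (v : 'rV['F_2]_N * 'rV['F_2]_N) : pauli v != 0.
Proof.
apply/eqP => /(congr1 (fun M => ent M v.1 0)); rewrite ent_pauli add0r eqxx mul1r.
by rewrite /ent mxE; apply/eqP/sg_neq0.
Qed.

Lemma pauli_comm_sympl N (v w : 'rV['F_2]_N * 'rV['F_2]_N) :
  pauli v *m pauli w = pauli w *m pauli v -> sympl v w = 0.
Proof.
rewrite pauli_comm pauliM => /eqP; rewrite -subr_eq0 -{2}[_ *: pauli _]scale1r -scalerBl.
rewrite scaler_eq0 scaler_eq0 (negPf (pauli_neq0 _ _)) (negPf (sg_neq0 _)) !orbF subr_eq0.
by move=> /eqP/sg_eq1.
Qed.

(** Completeness of the Pauli basis. Summing over b forces x' = z' by orthogonality of characters;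
    the translation part then allows only a = z + z', which gives x = z. *)
Lemma pauli_complete N (z z' x x' : 'rV['F_2]_N) :
  \sum_a \sum_b (ent (pauli (a, b)) z z')^* * ent (pauli (a, b)) x x'
  = (2 ^ N)%:R * ((x == z)%:R * (x' == z')%:R).
Proof.
transitivity (\sum_a ((z' + z == a)%:R : algC) *
    ((x == x' + a)%:R * ((2 ^ N)%:R * (x' == z')%:R))).
  apply: eq_bigr => a _.
  have -> : (x' == z') = (z' + x' == 0).
    by apply/eqP/eqP => [->|e]; [apply: addF2 | rewrite -(addF2K _ x' z') [x' + _]addrC e add0r].
  rewrite -sum_sg_dot !mulr_sumr; apply: eq_bigr => b _.
  rewrite !ent_pauli /= rmorphM /= sg_conj rmorph_nat dotDr sgD.
  have -> : (z == z' + a) = (z' + z == a).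
    by rewrite addrC eq_addF2 addrC.
  by ring.
rewrite (sum_delta _ (fun a => (x == x' + a)%:R * ((2 ^ N)%:R * (x' == z')%:R))).
case: (x' =P z') => [->|_]; last by rewrite !mulr0.
by rewrite addrA addF2 add0r; ring.
Qed.

(** * Clifford operators *)

Definition pauli_map {N : nat} (M : 'M[algC]_(2 ^ N)) : Prop :=
  forall v, exists w c, M *m pauli v *m adjmx M = c *: pauli w.

(** Both directions of conjugation are recorded: this makes the class closed under adjoints, and
    evolved states are studied through M^dagger P M. *)
Definition clif {N : nat} (M : 'M[algC]_(2 ^ N)) : Prop :=
  [/\ adjmx M *m M = 1%:M, pauli_map M & pauli_map (adjmx M)].

Lemma adjmx1 N : adjmx (1%:M : 'M[algC]_N) = 1%:M.
Proof. by rewrite /adjmx map_mx1 trmx1. Qed.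

Lemma adjmxZ p q c (A : 'M[algC]_(p, q)) : adjmx (c *: A) = c^* *: adjmx A.
Proof. by rewrite /adjmx map_mxZ linearZ. Qed.

Lemma adjmxD p q (A B : 'M[algC]_(p, q)) : adjmx (A + B) = adjmx A + adjmx B.
Proof. by rewrite /adjmx map_mxD linearD. Qed.

Lemma pauli_mapM N (A B : 'M[algC]_(2 ^ N)) :
  pauli_map A -> pauli_map B -> pauli_map (A *m B).
Proof.
move=> hA hB v; have [w [c e]] := hB v; have [w' [c' e']] := hA w.
exists w', (c * c'); rewrite adjmxM !mulmxA -(mulmxA A B) -(mulmxA A (B *m _)) e.
by rewrite -scalemxAr -scalemxAl e' scalerA.
Qed.

Lemma clif1 N : clif (1%:M : 'M[algC]_(2 ^ N)).
Proof.
have h : pauli_map (1%:M : 'M[algC]_(2 ^ N)).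
  by move=> v; exists v, 1; rewrite adjmx1 mul1mx mulmx1 scale1r.
by split; rewrite ?adjmx1 ?mulmx1.
Qed.

Lemma clifM N (A B : 'M[algC]_(2 ^ N)) : clif A -> clif B -> clif (A *m B).
Proof.
case=> uA A1 A2 [uB B1 B2]; split; rewrite ?adjmxM; try exact: pauli_mapM.
by rewrite !mulmxA -(mulmxA _ _ A) uA mulmx1.
Qed.

Lemma clif_adj N (A : 'M[algC]_(2 ^ N)) : clif A -> clif (adjmx A).
Proof. by case=> uA A1 A2; split; rewrite ?adjmxK // mulmx1C. Qed.

(* With s1, s2 the signs of [pauli v] commuting past [pauli v1], [pauli v2]: if s1 = s2 the
   cross terms cancel, and if s1 = - s2 the diagonal ones do. H and S are of this form. *)
Lemma comb_pauli_map N (v1 v2 : 'rV['F_2]_N * 'rV['F_2]_N) (a b : algC) :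
  dot v1.1 v1.2 = 0 -> dot v2.1 v2.2 = 0 ->
  a * a^* = 2^-1 -> b * b^* = 2^-1 -> a * b^* + sg (sympl v1 v2) * (b * a^*) = 0 ->
  forall v, exists w c, (a *: pauli v1 + b *: pauli v2) *m pauli v *m
     adjmx (a *: pauli v1 + b *: pauli v2) = c *: pauli w.
Proof.
move=> d1 d2 ha hb hab v.
have vv (w : 'rV['F_2]_N * 'rV['F_2]_N) : w + w = 0.
  by case: w => x y; congr (_, _); apply: addF2.
have [AA BB] : pauli v1 *m pauli v1 = 1%:M /\ pauli v2 *m pauli v2 = 1%:M.
  by rewrite !pauliM !vv (dotC _ v1.2) (dotC _ v2.2) d1 d2 sg0 !scale1r pauli0.
have BA : pauli v2 *m pauli v1 = sg (sympl v1 v2) *: (pauli v1 *m pauli v2).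
  by rewrite (pauli_comm _ v1 v2) scalerA sg_sq scale1r.
have e : (a *: pauli v1 + b *: pauli v2) *m pauli v *m
     adjmx (a *: pauli v1 + b *: pauli v2)
   = (sg (sympl v1 v) * (a * a^* ) + sg (sympl v2 v) * (b * b^* )) *: pauli v
   + (sg (sympl v1 v) * (a * b^* ) + sg (sympl v2 v) * (sg (sympl v1 v2) * (b * a^* )))
     *: (pauli v *m (pauli v1 *m pauli v2)).
  rewrite adjmxD !adjmxZ !pauli_adj d1 d2 sg0 !scale1r.
  rewrite mulmxDl -!scalemxAl !(pauli_comm _ _ v) !scalerA.
  rewrite mulmxDr !mulmxDl -!scalemxAl -!scalemxAr -!mulmxA BA AA BB mulmx1.
  rewrite -!scalemxAr !scalerA !scalerDl [X in _ + X = _]addrC addrACA [X in _ + X = _]addrC.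
  by congr (_ *: _ + _ *: _ + (_ *: _ + _ *: _)); ring.
rewrite e ha hb mulmxA pauliM -scalemxAl pauliM {e}.
have : sg (sympl v1 v) = sg (sympl v2 v) \/ sg (sympl v1 v) = - sg (sympl v2 v).
  by rewrite /sg; do 2 case: ifP => _; rewrite ?opprK; auto.
case=> ->.
  by rewrite -(mulrDr _ (a * b^* )) hab mulr0 scale0r addr0; do 2 eexists.
by rewrite mulNr addNr scale0r add0r !scalerA; do 2 eexists.
Qed.

(** An entry vanishes unless x and y agree away from q; over F_2 this leaves y = x and y = x +
    e_q. *)
Lemma ent_one N (q : 'I_N) G x y :
  ent (one_mx N q G) x y = (x == y)%:R * G (x 0 q == 1) (x 0 q == 1)
    + (x + delta_mx 0 q == y)%:R * G (x 0 q == 1) (x 0 q != 1).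
Proof.
have bE (z : 'rV['F_2]_N) (k : 'I_N) : bitn k (enc z) = (z 0 k == 1).
  by rewrite -{2}(encK _ z) mxE F2b.
rewrite /ent mxE !bE.
have -> : [forall k : 'I_N, (k != q :> nat) ==> (bitn k (enc x) == bitn k (enc y))] =
   [forall k : 'I_N, (k != q) ==> (x 0 k == y 0 k)].
  apply: eq_forallb => k; rewrite !bE; congr (_ ==> _).
  by case: (F2P (x 0 k)) => ->; case: (F2P (y 0 k)) => ->.
case: ifP => [/forallP xy|xy]; last first.
  case: (x =P y) => [e|_].
    by move/negP: xy; case; apply/forallP => k; rewrite e eqxx implybT.
  case: (x + _ =P y) => [e|_]; last by rewrite !mul0r addr0.
  move/negP: xy; case; apply/forallP => k; apply/implyP => kq.
  by rewrite -e !mxE (negPf kq) andbF addr0.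
have [e|e] := eqVneq (x 0 q) (y 0 q).
  have -> : x = y.
    by apply/rowP => k; have [->//|kq] := eqVneq k q; apply/eqP/(implyP (xy k)).
  rewrite eqxx mul1r; case: (_ + _ =P y) => [/rowP/(_ q)|_]; last by rewrite mul0r addr0.
  by rewrite !mxE !eqxx /=; case: (F2P (y 0 q)) => ->.
have -> : (x == y) = false by apply: contra_neqF e => /eqP ->.
have -> : x + delta_mx 0 q = y.
  apply/rowP => k; rewrite !mxE eqxx /=; have [->|kq] := eqVneq k q.
    by move: e; case: (F2P (x 0 q)) => ->; case: (F2P (y 0 q)) => -> // _; apply/eqP.
  by rewrite addr0; apply/eqP/(implyP (xy k)).
rewrite eqxx mul1r mul0r add0r; congr G.
by move: e; case: (F2P (x 0 q)) => ->; case: (F2P (y 0 q)) => ->.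
Qed.

Lemma amp_one N (q : 'I_N) G (u : 'cV_(2 ^ N)) x :
  amp (one_mx N q G *m u) x = G (x 0 q == 1) (x 0 q == 1) * amp u x
    + G (x 0 q == 1) (x 0 q != 1) * amp u (x + delta_mx 0 q).
Proof.
rewrite amp_mul -(sum_delta _ (fun y => G (x 0 q == 1) (x 0 q == 1) * amp u y) x).
rewrite -(sum_delta _ (fun y => G (x 0 q == 1) (x 0 q != 1) * amp u y) (x + _)) -big_split /=.
by apply: eq_bigr => y _; rewrite ent_one mulrDl !mulrA.
Qed.

Definition cnotf {N : nat} (c t : 'I_N) (x : 'rV['F_2]_N) : 'rV['F_2]_N :=
  x + x 0 c *: delta_mx 0 t.

Lemma cnotfK N (c t : 'I_N) : c != t -> involutive (cnotf c t).
Proof.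
move=> ct x; rewrite /cnotf !mxE eqxx (negPf ct) /= mulr0 addr0.
exact: addF2K.
Qed.

Lemma cnotfD N (c t : 'I_N) x y : cnotf c t (x + y) = cnotf c t x + cnotf c t y.
Proof. by rewrite /cnotf mxE scalerDl addrACA. Qed.

(** The transpose of a CNOT over F_2 exchanges control and target, which is how a CNOT acts on Z
    exponents. *)
Lemma dot_cnotf N (c t : 'I_N) b x : dot (cnotf t c b) x = dot b (cnotf c t x).
Proof.
rewrite /cnotf dotDl dotDr; congr (_ + _).
have dotZ (z y : 'rV['F_2]_N) r : dot z (r *: y) = r * dot z y.
  by rewrite /dot mulr_sumr; apply: eq_bigr => k _; rewrite mxE mulrCA.
by rewrite dotC !dotZ !dot_delta mulrC.
Qed.

Lemma bv_flip N (q : 'I_N) i : bv N (flipn q i) = bv N i + delta_mx 0 q.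
Proof.
apply/rowP => k; rewrite !mxE bitn_flip eqxx /= -(inj_eq val_inj).
by case: (bitn k i); case: eqP => _; apply/eqP.
Qed.

Lemma ent_cnot N (c t : 'I_N) x y :
  ent (cnot_mx N c t) x y = (x == cnotf c t y)%:R.
Proof.
rewrite /ent mxE; congr ((nat_of_bool _)%:R : algC).
set j := if _ then _ else _.
have jN : (j < 2 ^ N)%N by rewrite /j; case: ifP => // _; apply: flipn_lt.
have jE : bv N j = cnotf c t y.
  rewrite /j /cnotf; have -> : bitn c (enc y) = (y 0 c == 1).
    by rewrite -{2}(encK _ y) mxE F2b.
  case: (F2P (y 0 c)) => -> /=; first by rewrite scale0r addr0 encK.
  by rewrite bv_flip encK scale1r.
have -> : (x == cnotf c t y) = (bv N (enc x) == bv N j) by rewrite encK jE.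
by apply/eqP/eqP => [->|] //; apply: bv_inj.
Qed.

Lemma amp_cnot N (c t : 'I_N) (u : 'cV_(2 ^ N)) x : c != t ->
  amp (cnot_mx N c t *m u) x = amp u (cnotf c t x).
Proof.
move=> ct; rewrite amp_mul -(sum_delta _ (amp u)); apply: eq_bigr => y _.
by rewrite ent_cnot; congr ((nat_of_bool _)%:R * _); apply/eqP/eqP => [->|<-]; rewrite cnotfK.
Qed.

(** In M^dagger M the two diagonal terms contribute 1/2 each and the cross terms cancel. The adjoint
    has the same form with conjugated coefficients, so [comb_pauli_map] covers both directions of
    conjugation. *)
Lemma comb_clif N (v1 v2 : 'rV['F_2]_N * 'rV['F_2]_N) (a b : algC) :
  dot v1.1 v1.2 = 0 -> dot v2.1 v2.2 = 0 ->
  a * a^* = 2^-1 -> b * b^* = 2^-1 -> a * b^* + sg (sympl v1 v2) * (b * a^* ) = 0 ->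
  clif (a *: pauli v1 + b *: pauli v2).
Proof.
move=> d1 d2 ha hb hab.
have adjE : adjmx (a *: pauli v1 + b *: pauli v2) = a^* *: pauli v1 + b^* *: pauli v2.
  by rewrite adjmxD !adjmxZ !pauli_adj d1 d2 sg0 !scale1r.
have hab' : a^* * b + sg (sympl v1 v2) * (b^* * a) = 0.
  rewrite -[RHS](mulr0 (sg (sympl v1 v2))) -hab mulrDr mulrA mulrA sg_sq; ring.
split.
- have vv (w : 'rV['F_2]_N * 'rV['F_2]_N) : w + w = 0.
    by case: w => x y; congr (_, _); apply: addF2.
  rewrite adjE mulmxDl !mulmxDr -!scalemxAl -!scalemxAr !scalerA.
  have -> : pauli v2 *m pauli v1 = sg (sympl v1 v2) *: (pauli v1 *m pauli v2).
    by rewrite (pauli_comm _ v1 v2) scalerA sg_sq scale1r.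
  rewrite [X in _ + X]addrC addrACA scalerA -scalerDl.
  rewrite !pauliM !vv (dotC _ v1.2) (dotC _ v2.2) d1 d2 sg0 !scale1r pauli0.
  rewrite -scalerDl mulrC ha mulrC hb -(mulrC (sg _)) hab' scale0r addr0.
  by rewrite -[RHS]scale1r; congr (_ *: _); field.
- exact: comb_pauli_map.
- by rewrite adjE; apply: comb_pauli_map; rewrite ?conjCK // mulrC.
Qed.

Lemma sqrtC2_sq : sqrtC 2%:R * sqrtC 2%:R = 2%:R :> algC.
Proof. by rewrite -expr2 sqrtCK. Qed.

Lemma sqrtC2_conj : (sqrtC 2%:R : algC)^* = sqrtC 2%:R.
Proof. by apply/CrealP; rewrite ger0_real // sqrtC_ge0 ler0n. Qed.

Lemma ampD N (u v : 'cV_(2 ^ N)) x : amp (u + v) x = amp u x + amp v x.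
Proof. by rewrite /amp mxE. Qed.

Lemma ampZ N c (u : 'cV_(2 ^ N)) x : amp (c *: u) x = c * amp u x.
Proof. by rewrite /amp mxE. Qed.

Lemma Hgate_clif N (q : 'I_N) : clif (one_mx N q Hgate).
Proof.
pose a : algC := (sqrtC 2%:R)^-1; pose e : 'rV['F_2]_N := delta_mx 0 q.
have -> : one_mx N q Hgate = a *: pauli (e, 0) + a *: pauli (0, e).
  apply: op_eq => u x; rewrite amp_one mulmxDl -!scalemxAl.
  rewrite ampD !ampZ !amp_pauli /= addr0 (dotC _ 0) dot0r.
  rewrite (dotC _ e) dot_delta sg0 mul1r addrC /Hgate /a.
  by case: (F2P (x 0 q)) => ->; rewrite /sg /= ?mulN1r ?mul1r ?mulrN ?mulNr.
have ha : a * a^* = 2^-1.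
  by rewrite /a fmorphV /= sqrtC2_conj -invfM sqrtC2_sq.
apply: comb_clif => //=; rewrite ?(dotC _ 0) ?dot0r //.
rewrite /sympl /= dot0r add0r dot_delta mxE !eqxx /sg /=.
by rewrite mulN1r subrr.
Qed.

Lemma i_conj : ('i : algC)^* = - 'i.
Proof. exact: conjCi. Qed.

Lemma Sgate_clif N (q : 'I_N) : clif (one_mx N q Sgate).
Proof.
(* Writing diag(1, i) as aI + bZ requires a + b = 1 and a - b = i. *)
pose a : algC := (1 + 'i) / 2%:R; pose b : algC := (1 - 'i) / 2%:R.
pose e : 'rV['F_2]_N := delta_mx 0 q.
have ii : 'i * 'i = -1 :> algC by rewrite -expr2 sqrCi.
have -> : one_mx N q Sgate = a *: pauli (0, 0) + b *: pauli (0, e).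
  apply: op_eq => u x; rewrite amp_one mulmxDl -!scalemxAl.
  rewrite ampD !ampZ !amp_pauli /= !addr0 (dotC _ 0) dot0r.
  rewrite (dotC _ e) dot_delta sg0 mul1r /Sgate /a /b.
  by case: (F2P (x 0 q)) => ->; rewrite /sg /=; field.
have ca : a^* = (1 - 'i) / 2%:R.
  by rewrite /a rmorphM fmorphV rmorph_nat rmorphD rmorph1 /= i_conj.
have cb : b^* = (1 + 'i) / 2%:R.
  by rewrite /b rmorphM fmorphV rmorph_nat rmorphB rmorph1 /= i_conj opprK.
have n2 : (2%:R : algC) != 0 by rewrite pnatr_eq0.
apply: comb_clif => //=; rewrite ?(dotC _ 0) ?dot0r // ?ca ?cb /a /b.
- transitivity ((1 - 'i * 'i) / 4%:R : algC); first by field.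
  by rewrite ii; field.
- transitivity ((1 - 'i * 'i) / 4%:R : algC); first by field.
  by rewrite ii; field.
rewrite /sympl /= (dotC _ 0) !dot0r addr0 sg0 mul1r.
transitivity ((1 + 'i * 'i) / 2%:R : algC); first by field.
by rewrite ii subrr mul0r.
Qed.

Lemma cnot_clif N (c t : 'I_N) : c != t -> clif (cnot_mx N c t).
Proof.
move=> ct.
have sq : cnot_mx N c t *m cnot_mx N c t = 1%:M.
  by apply: op_eq => u x; rewrite -mulmxA !amp_cnot // cnotfK // mul1mx.
have adjE : adjmx (cnot_mx N c t) = cnot_mx N c t.
  apply: ent_eq => x y; rewrite ent_adj !ent_cnot rmorph_nat.
  by congr ((nat_of_bool _)%:R); apply/eqP/eqP => ->; rewrite cnotfK.
have pm : pauli_map (cnot_mx N c t).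
  move=> v; exists (cnotf c t v.1, cnotf t c v.2), 1; rewrite scale1r adjE.
  apply: op_eq => u x; rewrite -!mulmxA amp_cnot // amp_pauli amp_cnot // amp_pauli /=.
  have -> : x + cnotf c t v.1 = cnotf c t (cnotf c t x + v.1) by rewrite cnotfD cnotfK.
  by rewrite dot_cnotf cnotfK.
by split; rewrite ?adjE.
Qed.

Lemma gate_clif N g : gate_wf N g -> ~~ Defs.isT g -> clif (gate_mx N g).
Proof.
case: g => [q|q|c t|q] //= => [qN|qN|/andP[/andP[cN tN] ct]] _.
- exact: (Hgate_clif _ (Ordinal qN)).
- exact: (Sgate_clif _ (Ordinal qN)).
- exact: (cnot_clif _ (Ordinal cN) (Ordinal tN)).
Qed.

Lemma circ_cons N g C : circ_mx N (g :: C) = circ_mx N C *m gate_mx N g.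
Proof.
rewrite /circ_mx /= mulmx1 -{1}[gate_mx N g]mul1mx.
elim: C (1%:M : 'M[algC]_(2 ^ N)) => [|h C IH] M /=; first by [].
by rewrite mulmxA IH.
Qed.

Lemma circ_clif N C : clifford_circ N C -> clif (circ_mx N C).
Proof.
elim: C => [_|g C IH]; first exact: clif1.
rewrite circ_cons /clifford_circ /= negb_or => /andP[/andP[gN CN] /andP[gT CT]].
by apply: clifM; [apply: IH; rewrite /clifford_circ CN | apply: gate_clif].
Qed.

(** * Registers and gadgets *)

Lemma enc_row_mx n m (x : 'rV['F_2]_n) (y : 'rV['F_2]_m) :
  enc (row_mx x y) = (enc x + 2 ^ n * enc y)%N :> nat.
Proof.
apply: (bv_inj (n + m)); rewrite ?ltn_ord //; last by rewrite bv_cat // !encK.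
have := ltn_ord (enc x); have := ltn_ord (enc y); rewrite expnD.
move: (nat_of_ord (enc y)) (nat_of_ord (enc x)) => b a bm an.
by rewrite -(leq_pmul2l (expn_gt0 2 n)) mulnS in bm; lia.
Qed.

Lemma enc0 N : enc (0 : 'rV['F_2]_N) = 0%N :> nat.
Proof.
apply: (bv_inj N); rewrite ?ltn_ord ?expn_gt0 // encK.
by apply/rowP => k; rewrite !mxE /bitn div0n.
Qed.

Lemma vget_enc N (v : 'cV[algC]_(2 ^ N)) x : vget v (enc x) = amp v x.
Proof. by rewrite vget_bv ?encK. Qed.

Lemma amp_pad B t (v : 'cV[algC]_(2 ^ B)) x (g : 'rV['F_2]_t) :
  amp (pad (2 ^ (B + t)) v) (row_mx x g) = (g == 0)%:R * amp v x.
Proof.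
rewrite {1}/amp mxE enc_row_mx; case: eqP => [->|g0].
  by rewrite enc0 muln0 addn0 vget_enc mul1r.
(* A nonzero gadget label puts the index at or above 2^B, where [vget] takes its default value 0. *)
rewrite mul0r /vget insubF //; apply/negbTE; rewrite -leqNgt.
apply: leq_trans (leq_addl _ _); rewrite -{1}[(2 ^ B)%N]muln1 leq_mul2l.
rewrite lt0n; apply/orP; right; apply/eqP => e; apply: g0.
by rewrite -(encK _ g) -[RHS]encK enc0 e.
Qed.

Lemma amp_contract n m t psi (w : 'cV[algC]_(2 ^ (n + m + t))) d g :
  amp (contract n m (2 ^ (n + t)) (2 ^ (n + m + t)) psi w) (row_mx d g)
  = \sum_a (amp psi a)^* * amp w (row_mx (row_mx d a) g).
Proof.
rewrite {1}/amp mxE sum_enc; apply: eq_bigr => a _; congr (_ * _).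
have n0 : (0 < 2 ^ n)%N by rewrite expn_gt0.
rewrite -vget_enc !enc_row_mx [(enc d + _)%N]addnC [(2 ^ n * enc g)%N]mulnC.
rewrite modnMDl divnMDl // (modn_small (ltn_ord _)) (divn_small (ltn_ord _)) addn0.
by [].
Qed.

Lemma amp_contract0 n m psi (w : 'cV[algC]_(2 ^ (n + m))) d :
  amp (contract n m (2 ^ n) (2 ^ (n + m)) psi w) d
  = \sum_a (amp psi a)^* * amp w (row_mx d a).
Proof.
rewrite {1}/amp mxE sum_enc; apply: eq_bigr => a _; congr (_ * _).
by rewrite -vget_enc !enc_row_mx modn_small // divn_small // muln0 addn0.
Qed.

Lemma delta_lshift B t (q : 'I_B) :
  delta_mx 0 (lshift t q) = row_mx (delta_mx 0 q) 0 :> 'rV['F_2]_(B + t).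
Proof.
apply/rowP => k; rewrite !mxE eqxx /=; case: splitP => j kj; rewrite !mxE -val_eqE /= kj //.
by rewrite gtn_eqF // ltn_addr.
Qed.

Lemma delta_rshift B t (q : 'I_t) :
  delta_mx 0 (rshift B q) = row_mx 0 (delta_mx 0 q) :> 'rV['F_2]_(B + t).
Proof.
apply/rowP => k; rewrite !mxE eqxx /=; case: splitP => j kj; rewrite !mxE -val_eqE /= kj.
  by rewrite ltn_eqF // ltn_addr.
by rewrite eqn_add2l.
Qed.

Lemma one_base B t (q : 'I_B) G (u : 'cV_(2 ^ (B + t))) (v : 'cV_(2 ^ B)) g c :
  (forall x, amp u (row_mx x g) = c * amp v x) ->
  forall x, amp (one_mx (B + t) q G *m u) (row_mx x g) = c * amp (one_mx B q G *m v) x.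
Proof.
move=> uv x; rewrite amp_one (amp_one _ (lshift t q)) row_mxEl delta_lshift add_row_mx addr0.
by rewrite !uv; ring.
Qed.

(** A gate on the base wires fixes the gadget label, so a relation at a single [g] propagates; the
    factor [c] makes room for the gadget amplitude at that label. *)
Lemma gate_base B t h (u : 'cV_(2 ^ (B + t))) (v : 'cV_(2 ^ B)) g c : gate_wf B h ->
  (forall x, amp u (row_mx x g) = c * amp v x) ->
  forall x, amp (gate_mx (B + t) h *m u) (row_mx x g) = c * amp (gate_mx B h *m v) x.
Proof.
case: h => [q|q|c' t'|q] /= wf uv; try exact: (one_base _ _ (Ordinal wf)).
case/andP: wf => /andP[cB tB] ct x.
rewrite (amp_cnot _ (Ordinal cB) (Ordinal tB)) //.
rewrite (amp_cnot _ (lshift t (Ordinal cB)) (lshift t (Ordinal tB))) // -uv /cnotf.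
by rewrite row_mxEl delta_lshift scale_row_mx add_row_mx scaler0 addr0.
Qed.

Lemma circ_base B t C (u : 'cV_(2 ^ (B + t))) (v : 'cV_(2 ^ B)) g c : circ_wf B C ->
  (forall x, amp u (row_mx x g) = c * amp v x) ->
  forall x, amp (circ_mx (B + t) C *m u) (row_mx x g) = c * amp (circ_mx B C *m v) x.
Proof.
elim: C u v => [|h C IH] u v /=; first by rewrite /circ_mx /= !mul1mx.
case/andP => wh wC uv; rewrite !circ_cons -!mulmxA; apply: IH => //.
exact: gate_base.
Qed.

Lemma row_mx_surj B t (z : 'rV['F_2]_(B + t)) : exists x y, z = row_mx x y.
Proof. by exists (lsubmx z), (rsubmx z); rewrite hsubmxK. Qed.

Lemma circ_pad B t C (v : 'cV_(2 ^ B)) : circ_wf B C ->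
  circ_mx (B + t) C *m pad (2 ^ (B + t)) v = pad (2 ^ (B + t)) (circ_mx B C *m v).
Proof.
move=> wC; apply: amp_eq => z; have [x [g ->]] := row_mx_surj _ _ z.
rewrite amp_pad; apply: circ_base => // y; exact: amp_pad.
Qed.

(* The unnormalized |T>; the lost norm is the factor in T = sqrt 2 <0|CNOT|T>. *)
Definition tau1 (x : 'F_2) : algC := if x == 1 then omega8 else 1.

Definition tau {t : nat} (g : 'rV['F_2]_t) : algC := \prod_j tau1 (g 0 j).

(* Gadgets below [k] have been used: they are projected onto |0> and no later gate touches
   them, so only the part of [u] where their bits vanish matters. *)
Lemma gadget_amp B t C k (u : 'cV_(2 ^ (B + t))) (v : 'cV_(2 ^ B)) :
  circ_wf B C -> (k + countT C)%N = t ->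
  (forall x (g : 'rV_t), (forall j : 'I_t, (j < k)%N -> g 0 j = 0) ->
     amp u (row_mx x g) = (\prod_(j < t | (k <= j)%N) tau1 (g 0 j)) * amp v x) ->
  forall x, amp (circ_mx (B + t) (gadgetize B k C) *m u) (row_mx x 0)
          = amp (circ_mx B C *m v) x.
Proof.
elim: C k u v => [|h C IH] k u v.
  rewrite /= addn0 => _ -> uv x; rewrite /circ_mx /= !mul1mx uv => [|j _]; last by rewrite mxE.
  by rewrite big1 ?mul1r // => j; rewrite leqNgt ltn_ord.
case/andP => wh wC; have [hT|hT] := boolP (Defs.isT h).
  case: h wh hT => // q wq _ /= kt uv x.
  rewrite !circ_cons -!mulmxA; apply: (IH k.+1) => //; first by rewrite -kt; lia.
  move=> {}x g g0; have kt' : (k < t)%N by rewrite -kt /=; lia.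
  pose kk := Ordinal kt'.
  rewrite (amp_cnot _ (lshift t (Ordinal wq)) (rshift B kk)); last first.
    by rewrite -val_eqE /= ltn_eqF // ltn_addr.
  rewrite /cnotf row_mxEl delta_rshift scale_row_mx add_row_mx scaler0 addr0.
  rewrite uv => [|j jk]; last first.
    rewrite !mxE g0 ?(ltn_trans jk) // eqxx -val_eqE /= ltn_eqF //.
    by rewrite mulr0n mulr0 addr0.
  (* The CNOT adds the control bit to gadget bit k. Since g_k = 0, the factor at k is [tau1] of the
     control bit, which is the diagonal entry of T. *)
  rewrite (bigD1 kk) //= (amp_one _ (Ordinal wq)) /Tgate.
  have -> : (x 0 (Ordinal wq) == 1) == (x 0 (Ordinal wq) != 1) = false.
    by case: (_ == 1).
  rewrite eqxx mul0r addr0 !mxE !eqxx g0 // add0r mulr1 [RHS]mulrCA -mulrA; congr (_ * _).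
  congr (_ * _); apply: eq_big => [j|j /andP[_ jk]].
    by rewrite ltn_neqAle -val_eqE /= eq_sym andbC.
  by rewrite !mxE (negPf jk) andbF mulr0 addr0.
have [-> ->] : gadgetize B k (h :: C) = h :: gadgetize B k C /\ countT (h :: C) = countT C.
  by case: h hT {wh}.
move=> kt uv x; rewrite !circ_cons -!mulmxA; apply: (IH k) => // {}x g g0.
by apply: gate_base => // y; apply: uv.
Qed.

Lemma gadgetize_clif B t C k : circ_wf B C -> (k + countT C <= t)%N ->
  clifford_circ (B + t) (gadgetize B k C).
Proof.
rewrite /clifford_circ; elim: C k => [|h C IH] k //= /andP[wh wC] kt.
case: h wh kt => [q|q|c d|q] /=; last first.
  move=> wq kt; have := IH k.+1 wC; rewrite addSnnS => /(_ kt) /andP[-> ->].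
  rewrite !andbT (leq_trans wq (leq_addr _ _)) ltn_eqF ?(leq_trans wq (leq_addr _ _)) //.
  by rewrite ltn_add2l; lia.
all: move=> wq kt; have /andP[-> ->] := IH k wC kt; rewrite ?andbT.
- by case/andP: wq => /andP[cB dB] ->; rewrite !(leq_trans _ (leq_addr t B)).
- exact: leq_trans wq (leq_addr _ _).
- exact: leq_trans wq (leq_addr _ _).
Qed.

Lemma sum_row_mx a b (F : 'rV['F_2]_(a + b) -> algC) :
  \sum_z F z = \sum_x \sum_y F (row_mx x y).
Proof.
rewrite pair_big /= (reindex (fun p : 'rV_a * 'rV_b => row_mx p.1 p.2)) //=.
exists (fun z => (lsubmx z, rsubmx z)) => [[x y]|z] _ /=; last exact: hsubmxK.
by rewrite row_mxKl row_mxKr.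
Qed.

Definition ofamp {N : nat} (F : 'rV['F_2]_N -> algC) : 'cV[algC]_(2 ^ N) := \col_i F (bv N i).

Lemma amp_ofamp N F x : amp (@ofamp N F) x = F x.
Proof. by rewrite /amp mxE encK. Qed.

(* U = <0^t| Ut |T^t>, with the unnormalized |T>. *)
Lemma ent_gadget B t C y x : circ_wf B C -> countT C = t ->
  ent (circ_mx B C) y x = \sum_g tau g *
    ent (circ_mx (B + t) (gadgetize B 0 C)) (row_mx y 0) (row_mx x g).
Proof.
move=> wC Ct.
(* [v] is the basis state |x>, and [u] is |x> with an unnormalized |T> on every gadget, the starting
   point of [gadget_amp] at k = 0. *)
pose v : 'cV_(2 ^ B) := ofamp (fun z => (x == z)%:R).
pose u : 'cV_(2 ^ (B + t)) := ofamp (fun z => tau (rsubmx z) * (x == lsubmx z)%:R).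
have e : amp (circ_mx (B + t) (gadgetize B 0 C) *m u) (row_mx y 0)
       = amp (circ_mx B C *m v) y.
  apply: gadget_amp => // z g _.
  by rewrite !amp_ofamp row_mxKl row_mxKr; congr (_ * _); apply: eq_bigl => j.
transitivity (amp (circ_mx B C *m v) y).
  rewrite amp_mul -(sum_delta _ (fun z => ent _ y z)).
  by apply: eq_bigr => z _; rewrite amp_ofamp mulrC.
rewrite -e amp_mul sum_row_mx exchange_big; apply: eq_bigr => g _ /=.
rewrite -(sum_delta _ (fun z => tau g * ent _ _ (row_mx z g))).
by apply: eq_bigr => z _; rewrite amp_ofamp row_mxKl row_mxKr; ring.
Qed.

(** The adjoint of [ent_gadget]: padding with |0^t> keeps only gadget label 0 in the sum, and the
    amplitudes of |T> get conjugated. *)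
Lemma amp_gadget B t C (v : 'cV_(2 ^ B)) x : circ_wf B C -> countT C = t ->
  amp (adjmx (circ_mx B C) *m v) x = \sum_g (tau g)^* *
    amp (adjmx (circ_mx (B + t) (gadgetize B 0 C)) *m pad (2 ^ (B + t)) v) (row_mx x g).
Proof.
move=> wC Ct; rewrite amp_mul.
transitivity (\sum_y \sum_g (tau g)^* *
    ((ent (circ_mx (B + t) (gadgetize B 0 C)) (row_mx y 0) (row_mx x g))^* * amp v y)).
  apply: eq_bigr => y _; rewrite ent_adj (ent_gadget B t) // rmorph_sum mulr_suml.
  by apply: eq_bigr => g _; rewrite rmorphM mulrA.
rewrite exchange_big; apply: eq_bigr => g _ /=; rewrite -mulr_sumr; congr (_ * _).
rewrite amp_mul sum_row_mx; apply: eq_bigr => y _.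
rewrite (bigD1 0) //= big1 => [|h h0]; rewrite amp_pad ent_adj.
  by rewrite eqxx mul1r addr0.
by rewrite (negPf h0) mul0r mulr0.
Qed.

Lemma tau1_norm x : (tau1 x)^* * tau1 x = 1.
Proof.
rewrite /tau1 /omega8; case: ifP => _; last by rewrite rmorph1 mulr1.
rewrite fmorph_div rmorphD rmorph1 /= i_conj sqrtC2_conj.
have ii : 'i * 'i = -1 :> algC by rewrite -expr2 sqrCi.
rewrite mulrACA -invfM sqrtC2_sq mulrDl mul1r mulNr mulrDr ii mulr1.
by rewrite opprD opprK; field.
Qed.

(* <T|Z|T> = 0, with X^a Z^b containing a Z at position [j]. *)
Lemma tau_pauli t (r : 'rV['F_2]_t * 'rV['F_2]_t) (j : 'I_t) :
  r.1 0 j = 0 -> r.2 0 j = 1 ->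
  \sum_g \sum_h (tau g)^* * tau h * ent (pauli r) g h = 0.
Proof.
move=> r1 r2; rewrite exchange_big /=.
transitivity (\sum_h (tau (h + r.1))^* * tau h * sg (dot r.2 h)).
  apply: eq_bigr => h _.
  rewrite -(sum_delta _ (fun g => (tau g)^* * tau h * sg (dot r.2 h))).
  by apply: eq_bigr => g _; rewrite ent_pauli eq_sym mulrCA mulrA mulrC; ring.
(* Flipping bit j changes the sign because of the Z there. The [tau1] factors at j are unaffected:
   with no X at j they form a squared modulus, equal to 1 for both bit values. *)
apply: (sum_antisym _ (delta_mx 0 j)) => h.
rewrite dotDr dot_delta r2 sgD {2}/sg /= mulrN1 -mulrN; congr (_ * - _).
rewrite /tau !rmorph_prod -!big_split; apply: eq_bigr => k _ /=.
have [->|kj] := eqVneq k j; first by rewrite !mxE r1 !addr0 !tau1_norm.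
by rewrite !mxE (negPf kj) andbF !addr0.
Qed.

(** * The Pauli group of the projected states *)

(* Equivalently, each state [M |k>] is an eigenvector of [pauli v]. *)
Definition stabilizes {N : nat} (M : 'M[algC]_(2 ^ N)) (v : 'rV['F_2]_N * 'rV['F_2]_N) : bool :=
  is_diag_mx (adjmx M *m pauli v *m M).

Lemma stabilizes_mul N (M : 'M[algC]_(2 ^ N)) v w : clif M ->
  (adjmx M *m pauli v *m M) *m (adjmx M *m pauli w *m M)
  = adjmx M *m (pauli v *m pauli w) *m M.
Proof.
case=> /mulmx1C u _ _.
by rewrite -!mulmxA (mulmxA M (adjmx M)) u mul1mx.
Qed.

Lemma stabilizesD N (M : 'M[algC]_(2 ^ N)) v w : clif M ->
  stabilizes M v -> stabilizes M w -> stabilizes M (v + w).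
Proof.
move=> hM /diag_mxP[d dE] /diag_mxP[e eE].
have := stabilizes_mul _ _ v w hM; rewrite dE eE mulmx_diag pauliM => h.
apply/diag_mxP; exists (sg (dot v.2 w.1) *: \row_j (d 0 j * e 0 j)).
by rewrite linearZ /= h -scalemxAr -scalemxAl scalerA sg_sq scale1r.
Qed.

(** Simultaneously diagonalized operators commute. *)
Lemma stabilizes_sympl N (M : 'M[algC]_(2 ^ N)) v w : clif M ->
  stabilizes M v -> stabilizes M w -> sympl v w = 0.
Proof.
move=> hM /diag_mxP[d dE] /diag_mxP[e eE]; apply: pauli_comm_sympl.
have /(congr1 (fun X => M *m X *m adjmx M)) : adjmx M *m (pauli v *m pauli w) *m M
    = adjmx M *m (pauli w *m pauli v) *m M.
  by rewrite -!stabilizes_mul // dE eE diag_mxC.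
case: hM => /mulmx1C u _ _.
by rewrite !mulmxA u !mul1mx -!mulmxA u !mulmx1.
Qed.

(** M^dagger P M is a multiple of a single X^a Z^b. A nonzero diagonal entry forces a = 0, and then
    the whole matrix is diagonal. Thus a nonzero expectation in one state M|k> gives a condition
    that no longer mentions k. *)
Lemma stabilizes_diag N (M : 'M[algC]_(2 ^ N)) v k : clif M ->
  (adjmx M *m pauli v *m M) k k != 0 -> stabilizes M v.
Proof.
case=> _ _ /(_ v) [w [c]]; rewrite adjmxK /stabilizes => ->.
have [w0 _|w0] := eqVneq w.1 0; last first.
  by rewrite !mxE -{1}[bv N k]addr0 (inj_eq (addrI _)) (eq_sym 0 w.1) (negPf w0) mul0r mulr0 eqxx.
apply/is_diag_mxP => i j ij; rewrite !mxE w0 addr0 (inj_eq (@bvi_inj N)).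
by rewrite -val_eqE (negPf ij) mul0r mulr0.
Qed.

Lemma quad_form N (M P : 'M[algC]_(2 ^ N)) k (y := M *m delta_mx k 0 : 'cV_(2 ^ N)) :
  \sum_z \sum_z' (amp y z)^* * amp y z' * ent P z z' = (adjmx M *m P *m M) k k.
Proof.
rewrite mxE sum_enc exchange_big; apply: eq_bigr => z' _ /=.
rewrite mxE sum_enc mulr_suml; apply: eq_bigr => z _.
by rewrite /amp /y -!colE !mxE /ent mulrAC.
Qed.

(** The Pauli expansion of y y^dagger, obtained by inserting [pauli_complete]; the coefficients are
    the conjugated expectations of the Paulis in y. *)
Lemma rank_one_expansion N (y : 'cV[algC]_(2 ^ N)) x x' :
  amp y x * (amp y x')^* = \sum_v (2 ^ N)%:R^-1 *
    (\sum_z \sum_z' (amp y z)^* * amp y z' * ent (pauli v) z z')^* * ent (pauli v) x x'.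
Proof.
have N0 : ((2 ^ N)%:R : algC) != 0 by rewrite pnatr_eq0 expn_eq0.
have e z z' : \sum_v (ent (pauli v) z z')^* * ent (pauli v) x x'
    = (2 ^ N)%:R * ((x == z)%:R * (x' == z')%:R).
  by rewrite -pauli_complete pair_big; apply: eq_bigr => -[].
transitivity (\sum_z \sum_z' (2 ^ N)%:R^-1 * (amp y z * (amp y z')^* ) *
    \sum_v (ent (pauli v) z z')^* * ent (pauli v) x x'); last first.
  under eq_bigr => z _ do under eq_bigr => z' _ do rewrite mulr_sumr.
  under eq_bigr => z _ do rewrite exchange_big /=.
  rewrite exchange_big; apply: eq_bigr => v _ /=.
  rewrite rmorph_sum -mulrA mulr_suml mulr_sumr; apply: eq_bigr => z _.
  rewrite rmorph_sum mulr_suml mulr_sumr; apply: eq_bigr => z' _.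
  by rewrite !rmorphM /= conjCK; ring.
rewrite -(sum_delta _ (fun z => amp y z * (amp y x')^* )); apply: eq_bigr => z _.
rewrite -(sum_delta _ (fun z' => amp y z * (amp y z')^* )) mulr_sumr.
by apply: eq_bigr => z' _; rewrite e; field.
Qed.

Definition join3 {n m t : nat} (p : 'rV['F_2]_n * 'rV['F_2]_n)
  (q : 'rV['F_2]_m * 'rV['F_2]_m) (r : 'rV['F_2]_t * 'rV['F_2]_t) :
  'rV['F_2]_(n + m + t) * 'rV['F_2]_(n + m + t) :=
  (row_mx (row_mx p.1 q.1) r.1, row_mx (row_mx p.2 q.2) r.2).

Lemma join3D n m t (p p' : 'rV['F_2]_n * 'rV['F_2]_n) (q q' : 'rV['F_2]_m * 'rV['F_2]_m)
    (r r' : 'rV['F_2]_t * 'rV['F_2]_t) :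
  join3 p q r + join3 p' q' r' = join3 (p + p') (q + q') (r + r').
Proof. by congr (_, _); rewrite /= !add_row_mx. Qed.

Lemma sympl_join3 n m t (p p' : 'rV['F_2]_n * 'rV['F_2]_n) (q q' : 'rV['F_2]_m * 'rV['F_2]_m)
    (r r' : 'rV['F_2]_t * 'rV['F_2]_t) :
  sympl (join3 p q r) (join3 p' q' r') = sympl p p' + sympl q q' + sympl r r'.
Proof. by rewrite /sympl /= !dot_row_mx; ring. Qed.

Lemma ent_join3 n m t (p : 'rV['F_2]_n * 'rV['F_2]_n) (q : 'rV['F_2]_m * 'rV['F_2]_m)
    (r : 'rV['F_2]_t * 'rV['F_2]_t) d a g d' a' g' :
  ent (pauli (join3 p q r)) (row_mx (row_mx d a) g) (row_mx (row_mx d' a') g')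
  = ent (pauli p) d d' * ent (pauli q) a a' * ent (pauli r) g g'.
Proof.
rewrite !ent_pauli /= !dot_row_mx !sgD !add_row_mx.
have e b c (x x' : 'rV['F_2]_b) (y y' : 'rV['F_2]_c) :
    (row_mx x y == row_mx x' y') = (x == x') && (y == y').
  by apply/eqP/andP => [/eq_row_mx[-> ->]|[/eqP -> /eqP ->]].
by rewrite !e -!mulnb !natrM; ring.
Qed.

Lemma sum_join3 n m t (F : 'rV['F_2]_(n + m + t) * 'rV['F_2]_(n + m + t) -> algC) :
  \sum_v F v = \sum_p \sum_r \sum_q F (join3 p q r).
Proof.
rewrite pair_big pair_big /=.
rewrite (reindex (fun x => join3 x.1.1 x.2 x.1.2)) //=.
pose f (v : 'rV['F_2]_(n + m + t)) := (lsubmx (lsubmx v), rsubmx (lsubmx v), rsubmx v).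
exists (fun v => (((f v.1).1.1, (f v.2).1.1), ((f v.1).2, (f v.2).2), ((f v.1).1.2, (f v.2).1.2))).
  by move=> [[[p1 p2] [r1 r2]] [q1 q2]] _; rewrite /f /join3 /= !(row_mxKl, row_mxKr).
by move=> [x y] _; rewrite /f /join3 /= !hsubmxK.
Qed.

(** Contracting with psi replaces the ancilla factor P_q by its expectation in psi, so a pair
    survives only through some q that stabilizes the ancilla state as well. Asking for diagonality
    instead of a given eigenvalue serves all outcomes b at once. *)
Definition proj_group {n m t : nat} (D : 'M[algC]_(2 ^ (n + m + t))) (M : 'M[algC]_(2 ^ m)) :
  {set ('rV['F_2]_n * 'rV['F_2]_n) * ('rV['F_2]_t * 'rV['F_2]_t)} :=
  [set x | [exists q, stabilizes D (join3 x.1 q x.2) && stabilizes M q]].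

Lemma proj_groupD n m t (D : 'M[algC]_(2 ^ (n + m + t))) (M : 'M[algC]_(2 ^ m)) x y :
  clif D -> clif M -> x \in proj_group D M -> y \in proj_group D M ->
  x + y \in proj_group D M.
Proof.
move=> hD hM; rewrite !inE => /existsP[q /andP[xD xM]] /existsP[q' /andP[yD yM]].
apply/existsP; exists (q + q'); rewrite stabilizesD // andbT -join3D.
exact: stabilizesD.
Qed.

(** The full labels commute through D and their ancilla parts commute through M, so the remaining
    data and gadget contributions cancel. *)
Lemma proj_group_sympl n m t (D : 'M[algC]_(2 ^ (n + m + t))) (M : 'M[algC]_(2 ^ m)) x y :
  clif D -> clif M -> x \in proj_group D M -> y \in proj_group D M ->
  sympl x.1 y.1 + sympl x.2 y.2 = 0.
Proof.
move=> hD hM; rewrite !inE => /existsP[q /andP[xD xM]] /existsP[q' /andP[yD yM]].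
have := stabilizes_sympl _ _ _ _ hD xD yD.
by rewrite sympl_join3 (stabilizes_sympl _ _ _ _ hM xM yM) addr0.
Qed.

Lemma proj_expansion n m t (D : 'M[algC]_(2 ^ (n + m + t))) (M : 'M[algC]_(2 ^ m)) k l
    (F := fun d g => \sum_a (amp (M *m delta_mx l 0) a)^* *
                        amp (D *m delta_mx k 0) (row_mx (row_mx d a) g)) :
  clif D -> clif M ->
  exists c, (forall x, c x != 0 -> x \in proj_group D M) /\
    forall d d' g g', F d g * (F d' g')^* =
      \sum_p \sum_r c (p, r) * (ent (pauli p) d d' * ent (pauli r) g g').
Proof.
move=> hD hM.
pose cD v := (adjmx D *m pauli v *m D) k k; pose cM q := (adjmx M *m pauli q *m M) l l.
(* The coefficient sums, over ancilla parts q, the conjugated expectation of the joint Pauli in D|k>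
   times the expectation of P_q in M|l>. *)
exists (fun x => \sum_q (2 ^ (n + m + t))%:R^-1 * (cD (join3 x.1 q x.2))^* * cM q); split.
  move=> x; apply: contraR; rewrite inE negb_exists => /forallP h.
  apply/eqP; apply: big1 => q _; apply: contraNeq (h q).
  rewrite !mulf_eq0 !negb_or conjC_eq0 => /andP[/andP[_ hd] hm].
  by rewrite (stabilizes_diag _ _ _ _ hD hd) (stabilizes_diag _ _ _ _ hM hm).
move=> d d' g g'; rewrite /F rmorph_sum mulr_suml.
under eq_bigr => a _ do rewrite mulr_sumr.
set psi := M *m _; set y := D *m _.
transitivity (\sum_a \sum_a' \sum_p \sum_r \sum_q (amp psi a)^* * amp psi a' *
   ((2 ^ (n + m + t))%:R^-1 * (cD (join3 p q r))^* *
     (ent (pauli p) d d' * ent (pauli q) a a' * ent (pauli r) g g'))).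
  apply: eq_bigr => a _; apply: eq_bigr => a' _.
  rewrite rmorphM /= conjCK mulrACA rank_one_expansion sum_join3 mulr_sumr.
  apply: eq_bigr => p _; rewrite mulr_sumr; apply: eq_bigr => r _; rewrite mulr_sumr.
  by apply: eq_bigr => q _; rewrite quad_form ent_join3.
under eq_bigr => a _ do rewrite exchange_big /=.
rewrite exchange_big; apply: eq_bigr => p _ /=.
under eq_bigr => a _ do rewrite exchange_big /=.
rewrite exchange_big; apply: eq_bigr => r _ /=.
under eq_bigr => a _ do rewrite exchange_big /=.
rewrite exchange_big mulr_suml; apply: eq_bigr => q _ /=.
rewrite /cM -quad_form mulr_sumr mulr_suml; apply: eq_bigr => a _.
rewrite mulr_sumr mulr_suml; apply: eq_bigr => a' _.
by rewrite -/psi; ring.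
Qed.

(** * Counting *)

(** Let the rows of B be the labels in S, and let J exchange the X and Z halves. Isotropy says B
    (BJ)^T = 0 and J is invertible, so the rank of B is at most half of 2N. Elements of S are
    determined by their coordinates in a basis of the row space. *)
Lemma isotropic_card N (S : {set 'rV['F_2]_N * 'rV['F_2]_N}) :
  (forall v w, v \in S -> w \in S -> sympl v w = 0) -> (#|S| <= 2 ^ N)%N.
Proof.
move=> iso.
pose X := \matrix_(i < #|S|) (enum_val i).1; pose Z := \matrix_(i < #|S|) (enum_val i).2.
pose B := row_mx X Z.
have rkB : (\rank B <= N)%N.
  have /mulmx0_rank_max : B *m (row_mx Z X)^T = 0.
    rewrite tr_row_mx mul_row_col; apply/matrixP => i j; rewrite !mxE.
    rewrite addrC -[RHS](iso _ _ (enum_valP i) (enum_valP j)) /sympl.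
    by congr (_ + _); apply: eq_bigr => k _; rewrite !mxE.
  rewrite mxrank_tr; have -> : \rank (row_mx Z X) = \rank B.
    have <- : B *m block_mx 0 1%:M 1%:M 0 = row_mx Z X.
      by rewrite mul_row_block !mulmx0 !mulmx1 addr0 add0r.
    apply: mxrankMfree; apply/row_freeP; exists (block_mx 0 1%:M 1%:M 0).
    by rewrite mulmx_block !mulmx0 !mul0mx !mulmx1 !addr0 !add0r -scalar_mx_block.
  by lia.
apply: leq_trans (leq_pexp2l _ rkB) => //; rewrite -card_rVF2.
pose f (v : 'rV['F_2]_N * 'rV['F_2]_N) := row_mx v.1 v.2 *m pinvmx (row_base B).
suff /card_in_imset e : {in S &, injective f} by apply: leq_trans (max_card (f @: S)); rewrite e.
move=> v w vS wS fvw.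
have sub u : u \in S -> (row_mx u.1 u.2 <= row_base B)%MS.
  move=> uS; rewrite eq_row_base; have <- : row (enum_rank_in uS u) B = row_mx u.1 u.2.
    by rewrite row_row_mx !rowK enum_rankK_in.
  exact: row_sub.
have := congr1 (mulmx^~ (row_base B)) fvw; rewrite /f !mulmxKpV ?sub //.
by case: v {vS fvw} => v1 v2; case: w {wS} => w1 w2 /= /eq_row_mx[-> ->].
Qed.

(* All fibres of a subgroup over the second factor are translates of the kernel. *)
Lemma fiber_card n t (V := ('rV['F_2]_n * 'rV['F_2]_n)%type)
    (W := ('rV['F_2]_t * 'rV['F_2]_t)%type) (G : {set V * W}) (A : {set W}) :
  (forall x y, x \in G -> y \in G -> x + y \in G) ->
  (forall r, exists p, (p, r) \in G) ->
  (#|[set x in G | x.2 \in A]| * #|{: W}| = #|A| * #|G|)%N.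
Proof.
move=> GD Gs; pose K := #|[set x in G | x.2 == 0]|.
have fK r : #|[set x in G | x.2 == r]| = K.
  have [p pG] := Gs r.
  have pp : (p, r) + (p, r) = 0.
    by case: p r {pG} => [p1 p2] [r1 r2]; congr (_, _, (_, _)); apply: addF2.
  have -> : [set x in G | x.2 == r] = [set (x : V * W) + (p, r) | x in [set x in G | x.2 == 0]].
    apply/setP => x; apply/idP/imsetP => [|[y + ->]].
      rewrite inE => /andP[xG /eqP xr]; exists (x + (p, r)).
        by rewrite inE GD //= xr; apply/eqP/(congr1 snd pp).
      by rewrite -addrA pp addr0.
    by rewrite !inE => /andP[yG /eqP y0] /=; rewrite y0 add0r eqxx andbT GD.
  by rewrite card_imset //; apply: addIr.
have cnt (B : {set W}) : (#|[set x in G | x.2 \in B]| = #|B| * K)%N.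
  rewrite -sum1_card (partition_big (fun x : V * W => x.2) (mem B)) => [|x]; last first.
    by rewrite inE => /andP[].
  rewrite -sum_nat_const; apply: eq_bigr => r rB.
  rewrite -(fK r) -sum1_card; apply: eq_bigl => x; rewrite !inE /=.
  by case: eqP => [->|]; rewrite ?(rB : r \in B) ?andbT ?andbF.
have -> : #|G| = (#|{: W}| * K)%N.
  have := cnt [set: W]; rewrite cardsT => <-.
  by apply: eq_card => x; rewrite [in RHS]inE in_setT andbT.
by rewrite cnt mulnAC -mulnA.
Qed.

Lemma rank_le_card (F : fieldType) (T : finType) (S : {set T}) p q (X : 'M[F]_(p, q))
    (f : T -> 'rV[F]_q) :
  (forall i, exists c : T -> F, row i X = \sum_(s in S) c s *: f s) -> (\rank X <= #|S|)%N.
Proof.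
move=> h; pose Y := \matrix_(i < #|S|) f (enum_val i).
apply: leq_trans (rank_leq_row Y); apply: mxrankS; apply/row_subP => i.
have [c ->] := h i; apply: summx_sub => s sS; apply: scalemx_sub.
have -> : f s = row (enum_rank_in sS s) Y by rewrite rowK enum_rankK_in.
exact: row_sub.
Qed.

(** The exponent pair (0, 1) is Z; the pairs allowed at each gadget are I, X and, up to a phase,
    Y. *)
Definition no_Z {t : nat} : {set 'rV['F_2]_t * 'rV['F_2]_t} :=
  [set r : 'rV_t * 'rV_t | [forall j, (r.1 0 j, r.2 0 j) != (0, 1)]].

Lemma card_no_Z t : (#|@no_Z t| <= 3 ^ t)%N.
Proof.
pose f (r : 'rV['F_2]_t * 'rV['F_2]_t) := [ffun j => (r.1 0 j, r.2 0 j)].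
have c3 : #|predC1 ((0, 1) : 'F_2 * 'F_2)| = 3%N.
  by rewrite cardC1 card_prod !card_Fp.
have finj : injective f.
  move=> [a b] [a' b'] /ffunP e; congr (_, _); apply/rowP => j; have := e j;
  by rewrite !ffunE => -[].
rewrite -(card_imset _ finj).
have -> : (3 ^ t)%N = #|(ffun_on (predC1 ((0, 1) : 'F_2 * 'F_2)) : {pred {ffun 'I_t -> _}})|.
  by rewrite card_ffun_on c3 card_ord.
apply/subset_leq_card/subsetP => g /imsetP[r rA ->].
apply/ffun_onP => j; rewrite ffunE inE /=.
by move: rA; rewrite inE => /forallP/(_ j).
Qed.

Lemma proj_group_card n m t (D : 'M[algC]_(2 ^ (n + m + t))) (M : 'M[algC]_(2 ^ m)) :
  clif D -> clif M -> (#|@proj_group n m t D M| <= 2 ^ (n + t))%N.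
Proof.
move=> hD hM.
pose f (x : ('rV['F_2]_n * 'rV['F_2]_n) * ('rV['F_2]_t * 'rV['F_2]_t)) :=
  (row_mx x.1.1 x.2.1, row_mx x.1.2 x.2.2).
have finj : injective f.
  by move=> [[a b] [c d]] [[a' b'] [c' d']] [/eq_row_mx[/= -> ->] /eq_row_mx[/= -> ->]].
rewrite -(card_imset _ finj); apply: isotropic_card => v w /imsetP[x xG ->] /imsetP[y yG ->].
rewrite -(proj_group_sympl _ _ _ _ _ _ _ hD hM xG yG) /sympl /= !dot_row_mx; ring.
Qed.

Lemma sum_mem (T : finType) (V : nmodType) (S : {set T}) (F : T -> V) :
  (forall x, x \notin S -> F x = 0) -> \sum_x F x = \sum_(x in S) F x.
Proof.
move=> h; rewrite [RHS]big_mkcond; apply: eq_bigr => x _.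
by case: ifP => // /negbT /h.
Qed.

(* If A A^dagger is a nonzero multiple of 1 then every matrix on the gadgets is
   A X A^dagger for some X, so the gadget Paulis occurring in the group span everything. *)
Lemma max_ent_surj n t (G : {set ('rV['F_2]_n * 'rV['F_2]_n) * ('rV['F_2]_t * 'rV['F_2]_t)})
    (A : 'M[algC]_(2 ^ t, 2 ^ n)) c a :
  (forall x, c x != 0 -> x \in G) -> A *m adjmx A = a%:M -> a != 0 ->
  (forall g g' d d', A g d * (A g' d')^* =
      \sum_p \sum_r c (p, r) * (pauli p d d' * pauli r g g')) ->
  forall r, exists p, (p, r) \in G.
Proof.
move=> cG AA a0 AE.
pose R := [set r : 'rV['F_2]_t * 'rV['F_2]_t | [exists p, (p, r) \in G]].
suff RT : R = [set: _] by move=> r; apply/existsP; have := in_setT r; rewrite -RT inE.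
apply/eqP; rewrite eqEcard subsetT /= cardsT.
(* The 4^t gadget labels are counted as the dimension of the matrix space; it remains to express
   each matrix unit [B] through Paulis with label in [R]. *)
have -> : #|{: 'rV['F_2]_t * 'rV['F_2]_t}| = \rank (1%:M : 'M[algC]_(2 ^ t * 2 ^ t)).
  by rewrite mxrank1 card_prod !card_rVF2.
apply: (rank_le_card _ _ _ _ _ _ (fun r => mxvec (pauli r))) => i.
pose B := vec_mx (row i (1%:M : 'M[algC]_(2 ^ t * 2 ^ t))).
have [X BE] : exists X, B = A *m X *m adjmx A.
  (* A X A^dagger contains A A^dagger = a on either side of B, which the two inverses cancel. *)
  exists ((a^-1 * a^-1) *: (adjmx A *m B *m A)).
  rewrite -scalemxAr -scalemxAl !mulmxA AA mul_scalar_mx -!mulmxA -scalemxAl AA.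
  rewrite mul_mx_scalar !scalerA -[LHS]scale1r; congr (_ *: _); field; exact: a0.
exists (fun r => \sum_d \sum_d' X d d' * \sum_p c (p, r) * pauli p d d').
rewrite -[LHS]vec_mxK -/B; transitivity (mxvec (\sum_(r in R)
    (\sum_d \sum_d' X d d' * \sum_p c (p, r) * pauli p d d') *: (pauli r : 'M[algC]_(2 ^ t)))).
  congr mxvec; rewrite BE -sum_mem => [|r rR]; last first.
    rewrite big1 ?scale0r // => d _; rewrite big1 // => d' _; rewrite big1 ?mulr0 // => p _.
    have [->|/cG pG] := eqVneq (c (p, r)) 0; first by rewrite mul0r.
    by case/negP: rR; rewrite inE; apply/existsP; exists p.
  apply/matrixP => g g'; rewrite !mxE summxE.
  transitivity (\sum_d \sum_d' X d d' * (A g d * (A g' d')^* )).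
    rewrite exchange_big; apply: eq_bigr => d' _ /=; rewrite !mxE mulr_suml.
    by apply: eq_bigr => d _; ring.
  under eq_bigr => d _ do under eq_bigr => d' _ do rewrite AE exchange_big mulr_sumr /=.
  under eq_bigr => d _ do rewrite exchange_big /=.
  rewrite exchange_big; apply: eq_bigr => r _ /=; rewrite [RHS]mxE mulr_suml.
  apply: eq_bigr => d _; rewrite mulr_suml; apply: eq_bigr => d' _.
  by rewrite -mulrA mulr_suml; congr (_ * _); apply: eq_bigr => p _; ring.
by rewrite linear_sum; apply: eq_bigr => r _; rewrite linearZ.
Qed.

(** * Assembling the bound *)

Lemma ket0E N : ket0 N = delta_mx (enc 0) 0.
Proof. by apply/colP => i; rewrite !mxE andbT -val_eqE /= enc0. Qed.

Lemma amp_delta N k x : amp (delta_mx k 0 : 'cV_(2 ^ N)) x = (x == bv N k)%:R.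
Proof.
rewrite /amp mxE andbT -{1}[k]bvK; congr ((nat_of_bool _)%:R).
exact: (inj_eq (bij_inj (@enc_bij N))).
Qed.

Lemma pad_delta B t k :
  pad (2 ^ (B + t)) (delta_mx k 0 : 'cV_(2 ^ B)) = delta_mx (enc (row_mx (bv B k) 0)) 0.
Proof.
apply: amp_eq => z; have [x [g ->]] := row_mx_surj _ _ z.
rewrite amp_pad !amp_delta encK -natrM mulnb; congr ((nat_of_bool _)%:R).
by apply/andP/eqP => [[/eqP -> /eqP ->]//|/eq_row_mx[-> ->]].
Qed.

Lemma adj_mul_eq0 p q (A : 'M[algC]_(p, q)) : A *m adjmx A = 0 -> A = 0.
Proof.
move=> /matrixP AA; apply/matrixP => i j; have := AA i i; rewrite !mxE => /eqP.
rewrite psumr_eq0 => [/allP/(_ j)|k _]; last by rewrite !mxE mul_conjC_ge0.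
by rewrite mem_index_enum !mxE mul_conjC_eq0 => /(_ isT)/eqP.
Qed.

Lemma clifford_circ_widen N K C : clifford_circ N C -> clifford_circ (N + K) C.
Proof.
rewrite /clifford_circ => /andP[wf ->]; rewrite andbT; apply: sub_all wf.
have le q : (q < N)%N -> (q < N + K)%N by move=> h; apply: leq_trans h (leq_addr _ _).
by move=> [q|q|c d|q] /= => [/le|/le|/andP[/andP[/le -> /le ->] ->]|/le].
Qed.

(** The vector whose projector is mu_b is <T^t| applied to phi_b. With the unnormalized |T> of [tau]
    no power of sqrt 2 appears. *)
Lemma amp_povm_vector n m t U psi (Phib : 'cV[algC]_(2 ^ (n + m))) d :
  circ_wf (n + m) U -> countT U = t ->
  amp (contract n m (2 ^ n) (2 ^ (n + m)) psi (adjmx (circ_mx (n + m) U) *m Phib)) d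
  = \sum_g (tau g)^* * amp (proj_heis n m t U psi Phib) (row_mx d g).
Proof.
move=> wU Ut; rewrite amp_contract0.
under eq_bigr => a _ do rewrite (amp_gadget _ t) // mulr_sumr.
rewrite exchange_big; apply: eq_bigr => g _ /=; rewrite amp_contract mulr_sumr.
by apply: eq_bigr => a _; rewrite mulrCA.
Qed.

Theorem theorem6 (n m t : nat) (Htn : (t <= n)%N) (Htm : (t <= m)%N)
  (U : seq gate) (HUwf : circ_wf (n + m) U) (HUt : countT U = t)
  (psi : 'cV[algC]_(2 ^ m)) (Hpsi : stab_state m psi)
  (Phi : 'I_(2 ^ (n + m)) -> 'cV[algC]_(2 ^ (n + m))) (HPhi : stab_basis (n + m) Phi)
  (Hent : forall b : 'I_(2 ^ (n + m)),
      proj_heis n m t U psi (Phi b) != 0 -> max_ent n t (proj_heis n m t U psi (Phi b))) :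
  ((povm_span_dim n m U psi Phi)%:R : rat) <= 2%:R ^+ n * (3%:R / 2%:R) ^+ t.
Proof.
have [CM [CMc psiE]] := Hpsi; have [CP [CPc PhiE]] := HPhi.
pose M := circ_mx m CM.
pose D := adjmx (circ_mx (n + m + t) (gadgetize (n + m) 0 U)) *m circ_mx (n + m + t) CP.
have hM : clif M by apply: circ_clif.
have hD : clif D.
  apply: clifM; first by apply/clif_adj/circ_clif/gadgetize_clif; rewrite // HUt.
  exact/circ_clif/clifford_circ_widen.
pose phi b := proj_heis n m t U psi (Phi b).
have phi_exp b : exists c, (forall x, c x != 0 -> x \in @proj_group n m t D M) /\
    forall d d' g g', amp (phi b) (row_mx d g) * (amp (phi b) (row_mx d' g'))^* =
      \sum_p \sum_r c (p, r) * (ent (pauli p) d d' * ent (pauli r) g g').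
  (* Phi_b with gadgets in |0^t> is the widened basis circuit [CP] applied to |b, 0^t>, and psi is
     M|0>. *)
  have [c [cG cE]] := proj_expansion n m t D M (enc (row_mx (bv (n + m) b) 0)) (enc 0) hD hM.
  exists c; split=> // d d' g g'; rewrite -cE.
  rewrite /phi /proj_heis !amp_contract PhiE -circ_pad; last by case/andP: CPc.
  by rewrite pad_delta !mulmxA psiE ket0E.
(* If every phi_b vanishes, no maximally entangled state is available, but then all POVM elements
   are 0. Otherwise a single nonzero phi_b suffices, since the group is common to all b. *)
have [/forallP phi0|] := boolP [forall b, phi b == 0].
  have -> : povm_span_dim n m U psi Phi = 0%N.
    rewrite /povm_span_dim; apply/eqP; rewrite mxrank_eq0; apply/eqP/row_matrixP => b.
    rewrite rowK row0 /povm_elt; set w := contract _ _ _ _ _ _.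
    suff -> : w = 0 by rewrite mul0mx linear0.
    apply: amp_eq => d; rewrite (amp_povm_vector _ _ t) // big1 => [|g _].
      by rewrite /amp mxE.
    by rewrite -/(phi b) (eqP (phi0 b)) /amp mxE mulr0.
  by rewrite mulr_ge0 // exprn_ge0.
rewrite negb_forall => /existsP[b0 phib0].
have surj : forall r, exists p, (p, r) \in @proj_group n m t D M.
  have [a] := Hent b0 phib0.
  set A := \matrix_(g, d) _ => AA.
  have AE g d : A g d = amp (phi b0) (row_mx (bv n d) (bv t g)).
    by rewrite mxE -vget_enc enc_row_mx !bvK.
  have [c [cG cE]] := phi_exp b0.
  apply: (max_ent_surj _ _ _ _ _ _ cG AA) => [|g g' d d'].
    (* The proportionality constant is nonzero: a = 0 would give A A^dagger = 0, hence A = 0 and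
       phi_b = 0. *)
    apply: contra_neq phib0 => a0; apply: amp_eq => z; have [x [g ->]] := row_mx_surj _ _ z.
    have /matrixP/(_ (enc g) (enc x)) : A = 0.
      by apply: adj_mul_eq0; rewrite AA a0 raddf0.
    by rewrite AE !encK mxE => ->; rewrite /amp mxE.
  by rewrite !AE cE /ent !bvK.
pose S := [set x in @proj_group n m t D M | x.2 \in no_Z].
have rkS : (povm_span_dim n m U psi Phi <= #|S|)%N.
  apply: (rank_le_card _ _ _ _ _ _ (fun x => mxvec (pauli x.1))) => b.
  have [c [cG cE]] := phi_exp b.
  (* [T r] is <T^t|P_r|T^t>, the factor left on P_p in mu_b once the gadgets are contracted. *)
  pose T (r : 'rV['F_2]_t * 'rV['F_2]_t) := \sum_g \sum_h (tau g)^* * tau h * ent (pauli r) g h.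
  exists (fun x => c x * T x.2); rewrite rowK.
  transitivity (mxvec (\sum_(x in S) (c x * T x.2) *: pauli x.1)); last first.
    by rewrite linear_sum; apply: eq_bigr => x _; rewrite linearZ.
  congr mxvec; rewrite -sum_mem => [|x]; last first.
    rewrite inE negb_and => /orP[xG|].
      have [->|/cG] := eqVneq (c x) 0; first by rewrite mul0r scale0r.
      by rewrite (negPf xG).
    rewrite inE negb_forall => /existsP[j]; rewrite negbK => /eqP[r1 r2].
    by rewrite /T (tau_pauli _ _ j) // mulr0 scale0r.
  apply: ent_eq => d d'.
  transitivity (\sum_g \sum_h (tau g)^* * tau h *
      \sum_p \sum_r c (p, r) * (ent (pauli p) d d' * ent (pauli r) g h)).
    rewrite /povm_elt; have := fun d => amp_povm_vector _ _ t _ psi (Phi b) d HUwf HUt.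
    move: (contract _ _ _ _ _ _) => w wE.
    rewrite {1}/ent mxE big_ord1 !mxE -!/(amp _ _) !wE.
    rewrite rmorph_sum mulr_suml; apply: eq_bigr => g _; rewrite mulr_sumr.
    by apply: eq_bigr => h _; rewrite -cE rmorphM /= conjCK mulrACA.
  rewrite [RHS]/ent summxE.
  transitivity (\sum_p \sum_r ((c (p, r) * T r) *: pauli p) (enc d) (enc d')); last first.
    by rewrite pair_big; apply: eq_bigr => -[].
  under eq_bigr => g _ do under eq_bigr => h _ do rewrite mulr_sumr.
  under eq_bigr => g _ do rewrite exchange_big /=.
  rewrite exchange_big; apply: eq_bigr => p _ /=.
  under eq_bigr => g _ do under eq_bigr => h _ do rewrite mulr_sumr.
  under eq_bigr => g _ do rewrite exchange_big /=.
  rewrite exchange_big; apply: eq_bigr => r _ /=.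
  rewrite mxE -/(ent _ _ _) /T mulr_sumr mulr_suml; apply: eq_bigr => g _.
  by rewrite mulr_sumr mulr_suml; apply: eq_bigr => h _; ring.
have := fiber_card _ _ _ no_Z (fun x y => proj_groupD _ _ _ D M x y hD hM) surj.
rewrite -/S card_prod !card_rVF2 => cardS.
have : (povm_span_dim n m U psi Phi * 2 ^ t <= 2 ^ n * 3 ^ t)%N.
  (* The fibre count gives |S| 4^t = |no_Z| |G|, at most 3^t 2^(n+t). The extra factor 2^t produces
     this 4^t on the left and is cancelled on the right. *)
  rewrite -(leq_pmul2r (expn_gt0 2 t)) -mulnA.
  apply: leq_trans (leq_mul rkS (leqnn _)) _; rewrite cardS.
  apply: leq_trans (leq_mul (card_no_Z t) (proj_group_card _ _ _ _ _ hD hM)) _.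
  by rewrite expnD mulnCA mulnA.
rewrite -(ler_nat rat) !natrM !natrX => le; rewrite expr_div_n mulrA ler_pdivlMr //.
by rewrite exprn_gt0.
Qed.
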